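(* Let $m\ge3$ and let $C_m=\mathrm{Comm}_{\mathrm{Aut}(T)}(W_m)$ be the relative commensurator of the free Coxeter group $W_m$ of rank $m$ in the automorphism group of its Cayley tree $T$. Then: (i) $C_m$ is almost simple. (ii) The simple monolith $\mathrm{Mon}(C_m)$ contains a finite index subgroup of $W_m$. (iii) The closure of $\mathrm{Mon}(C_m)$ in $\mathrm{Aut}(T)$ coincides with $\mathrm{Aut}(T)^+$. (iv) $\mathrm{Mon}(C_m)$ is not finitely generated.
   Context: $W_m$ is the free product of $m$ copies of the cyclic group of order $2$; its Cayley tree $T$ is the $m$-regular tree, on which $W_m$ acts simply transitively on vertices, so $W_m\le\mathrm{Aut}(T)$. $\mathrm{Aut}(T)^+$ is the index $2$ subgroup of $\mathrm{Aut}(T)$ preserving the canonical bipartition of $V(T)$. For $\Gamma\le G$, the relative commensurator is $\mathrm{Comm}_G(\Gamma)=\{g\in G\mid[\Gamma:\Gamma\cap g\Gamma g^{-1}]<\infty\}$ (for the $\Gamma$ and $G$ considered here this is a subgroup of $G$). A group $G$ is monolithic if the intersection of all its non-identity normal subgroups is non-trivial; that intersection is the monolith $\mathrm{Mon}(G)$. $G$ is almost simple if it is monolithic and its monolith is a non-abelian simple group. *)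

(* Defs.v *)
From HB Require Import structures.
From mathcomp Require Import all_boot.
From mathcomp Require Import all_classical.
From mathcomp Require Import topology.

Set Implicit Arguments.
Unset Strict Implicit.
Unset Printing Implicit Defensive.

Local Open Scope classical_set_scope.
Local Open Scope group_scope.

(* As in [fingroup], subgroups are sets [H : set G] of an ambient group, which
   may be infinite here, and a predicate on [H] is about the group [H]. *)

Section Subgroups.
Variable G : groupType.
Implicit Types H K N S : set G.

Definition is_subgroup H : Prop := group_closed (mem H).

Lemma is_subgroupP H :
  is_subgroup H <->
  [/\ H 1, (forall x y, H x -> H y -> H (x * y)) & forall x, H x -> H x^-1].
Proof.
split=> [sH | [H1 HM HV]].
  have HM := group_closedM sH; have HV := group_closedV sH.
  case: sH => H1 _; split=> [|x y Hx Hy|x Hx]; first by apply/set_mem.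
    by apply/set_mem; apply: HM; apply/mem_set.
  by apply/set_mem; apply: HV; apply/mem_set.
split=> [|x y /set_mem Hx /set_mem Hy]; apply/mem_set => //.
exact/HM/HV.
Qed.

Definition lcoset_set H x : set G := [set x * h | h in H].

(* The index of [H] in [K] is finite; only used for subgroups [H `<=` K]. *)
Definition finite_index H K : Prop := finite_set [set lcoset_set H x | x in K].

Definition conj_set g H : set G := [set g * h * g^-1 | h in H].

Definition commensurator H : set G :=
  [set g | finite_index (H `&` conj_set g H) H].

Definition normal_subgroup N H : Prop :=
  [/\ is_subgroup N, N `<=` H &
      forall g x, H g -> N x -> N (g * x * g^-1)].

Definition is_abelian H : Prop := forall x y, H x -> H y -> commute x y.

Definition is_simple H : Prop :=
  [/\ is_subgroup H, H <> [set 1] &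
      forall N, normal_subgroup N H -> N = [set 1] \/ N = H].

(* Intersecting with [H] only matters for [H] trivial, where the family of
   non-identity normal subgroups is empty and [\bigcap] is the whole of [G]. *)
Definition monolith H : set G :=
  H `&` \bigcap_(N in [set N | normal_subgroup N H /\ N <> [set 1]]) N.

Definition is_monolithic H : Prop := is_subgroup H /\ monolith H <> [set 1].

Definition almost_simple H : Prop :=
  [/\ is_monolithic H, is_simple (monolith H) & ~ is_abelian (monolith H)].

Definition finitely_generated H : Prop :=
  exists2 S, finite_set S & H = smallest is_subgroup S.

End Subgroups.

(* The free product of [m] copies of the cyclic group of order 2, realised by
   its normal forms: words in the [m] generators in which no two consecutive
   letters are equal. *)

Section FreeCoxeter.
Variable m : nat.
Implicit Types (i j : 'I_m) (s t u : seq 'I_m).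

Definition reduced s : bool := sorted [rel i j | i != j] s.

Record free_coxeter := FreeCoxeter {
  cox_word :> seq 'I_m;
  cox_reduced : reduced cox_word
}.

HB.instance Definition _ := [isSub for cox_word].
HB.instance Definition _ := [Choice of free_coxeter by <:].

Definition cox_lmul i s : seq 'I_m :=
  if s is j :: s' then if i == j then s' else i :: s else [:: i].

Definition cox_mulw s t : seq 'I_m := foldr cox_lmul t s.

Lemma reduced_lmul i s : reduced s -> reduced (cox_lmul i s).
Proof.
case: s => [//|j s] /= rs; case: eqP => [_|/eqP nij]; last by rewrite /= nij.
exact: path_sorted rs.
Qed.

Lemma reduced_mulw s t : reduced t -> reduced (cox_mulw s t).
Proof. by move=> rt; elim: s => //= i s; apply: reduced_lmul. Qed.

Lemma cox_lmulK i s : reduced s -> cox_lmul i (cox_lmul i s) = s.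
Proof.
case: s => [|j s] /=; first by rewrite eqxx.
case: (eqVneq i j) => [<-|_ _] /=; last by rewrite eqxx.
by case: s => //= k s /andP[/negbTE ->].
Qed.

Lemma cox_mulw_lmul i s t :
  reduced t -> cox_mulw (cox_lmul i s) t = cox_lmul i (cox_mulw s t).
Proof.
move=> rt; case: s => //= j s; case: (eqVneq i j) => [<-|//] /=.
by rewrite cox_lmulK //; apply: reduced_mulw.
Qed.

Lemma cox_mulwA s t u :
  reduced u -> cox_mulw s (cox_mulw t u) = cox_mulw (cox_mulw s t) u.
Proof. by move=> ru; elim: s => //= i s ->; rewrite cox_mulw_lmul. Qed.

Lemma cox_mulws0 s : reduced s -> cox_mulw s [::] = s.
Proof.
elim: s => //= i s IHs rs; rewrite IHs; last exact: path_sorted rs.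
by case: s rs {IHs} => //= j s /andP[/negbTE ->].
Qed.

Lemma reduced_rev s : reduced (rev s) = reduced s.
Proof.
by rewrite /reduced rev_sorted; apply: eq_sorted => i j /=; rewrite eq_sym.
Qed.

Lemma cox_mulVw s : cox_mulw (rev s) s = [::].
Proof.
elim: s => // i s IHs.
by rewrite rev_cons /cox_mulw -cats1 foldr_cat /= eqxx.
Qed.

Definition cox_one : free_coxeter := @FreeCoxeter [::] isT.

Definition cox_mul (x y : free_coxeter) : free_coxeter :=
  FreeCoxeter (reduced_mulw x (cox_reduced y)).

Lemma cox_inv_subproof (x : free_coxeter) : reduced (rev x).
Proof. by rewrite reduced_rev; apply: cox_reduced. Qed.

Definition cox_inv (x : free_coxeter) : free_coxeter :=
  FreeCoxeter (cox_inv_subproof x).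

Lemma cox_mulA : associative cox_mul.
Proof. by move=> x y z; apply/val_inj/cox_mulwA/cox_reduced. Qed.

Lemma cox_mul1 : left_id cox_one cox_mul.
Proof. by move=> x; apply/val_inj. Qed.

Lemma cox_mulr1 : right_id cox_one cox_mul.
Proof. by move=> x; apply/val_inj/cox_mulws0/cox_reduced. Qed.

Lemma cox_mulV : left_inverse cox_one cox_inv cox_mul.
Proof. by move=> x; apply/val_inj/cox_mulVw. Qed.

Lemma cox_mulrV : right_inverse cox_one cox_inv cox_mul.
Proof.
by move=> x; apply/val_inj; have := cox_mulVw (rev x); rewrite revK.
Qed.

HB.instance Definition _ := isGroup.Build free_coxeter
  cox_mulA cox_mul1 cox_mulr1 cox_mulV cox_mulrV.

Definition cox_gen i : free_coxeter := @FreeCoxeter [:: i] isT.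

Lemma cox_genK i : cox_gen i * cox_gen i = 1.
Proof. by apply/val_inj; rewrite /= eqxx. Qed.

(* Universal property of the free product of [m] groups of order 2. *)
Lemma free_coxeter_universal (G : groupType) (a : 'I_m -> G) :
  (forall i, a i * a i = 1) ->
  exists! f : free_coxeter -> G,
    (forall x y, f (x * y) = f x * f y) /\ (forall i, f (cox_gen i) = a i).
Proof.
move=> a2; pose f (x : free_coxeter) := \prod_(i <- cox_word x) a i.
have fl i s : \prod_(j <- cox_lmul i s) a j = a i * \prod_(j <- s) a j.
  case: s => [|j s] /=; first by rewrite big_seq1 big_nil mulg1.
  by case: eqP => [<-|_]; rewrite !big_cons // mulgA a2 mul1g.
have fM x y : f (x * y) = f x * f y.
  rewrite /f /=; elim: (cox_word x) => [|i s IHs] /=.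
    by rewrite big_nil mul1g.
  by rewrite fl IHs big_cons mulgA.
exists f; split=> [|g [gM gg]].
  by split=> // i; rewrite /f /= big_seq1.
have g1 : g 1 = 1.
  by apply: (mulgI (g 1)); rewrite -gM !mulg1.
apply/funext => -[s rs]; rewrite /f /=.
elim: s rs => [|i s IHs] rs.
  by rewrite big_nil -g1; congr g; apply/val_inj.
have rs' : reduced s by exact: path_sorted rs.
rewrite big_cons (IHs rs') -gg -gM; congr g; apply/val_inj => /=.
by case: s rs {IHs rs'} => //= j s /andP[/negbTE ->].
Qed.

(* Adjacency in the Cayley graph with respect to the [m] generators, on which
   the group acts by left multiplication. *)
Definition cayley_adj : rel free_coxeter :=
  [rel x y | [exists i, y == x * cox_gen i]].

End FreeCoxeter.

Section GraphAut.
Variables (V : choiceType) (e : rel V).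

Record graph_aut := GraphAut {
  aut_fun :> V -> V;
  aut_bij : bijective aut_fun;
  aut_adj : forall x y, e (aut_fun x) (aut_fun y) = e x y
}.

Implicit Types f g h : graph_aut.

Lemma graph_autP f g : f =1 g -> f = g.
Proof.
case: f g => [f fb fe] [g gb ge] /= /funext fg.
by case: g / fg gb ge => gb ge; congr GraphAut; apply: Prop_irrelevance.
Qed.

HB.instance Definition _ := gen_eqMixin graph_aut.
HB.instance Definition _ := gen_choiceMixin graph_aut.

Definition aut_one : graph_aut :=
  @GraphAut id (Bijective (frefl _) (frefl _)) (fun _ _ => erefl).

Lemma aut_mul_adj f g x y : e (f (g x)) (f (g y)) = e x y.
Proof. by rewrite !aut_adj. Qed.

Definition aut_mul f g : graph_aut :=
  @GraphAut (f \o g) (bij_comp (aut_bij f) (aut_bij g)) (aut_mul_adj f g).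

Lemma aut_inv_subproof f : exists k : V -> V, cancel f k /\ cancel k f.
Proof. by case: (aut_bij f) => k fK kK; exists k. Qed.

Definition aut_invf f : V -> V := sval (cid (aut_inv_subproof f)).

Lemma aut_funK f : cancel f (aut_invf f).
Proof. by rewrite /aut_invf; case: cid => ? []. Qed.

Lemma aut_invfK f : cancel (aut_invf f) f.
Proof. by rewrite /aut_invf; case: cid => ? []. Qed.

Lemma aut_inv_adj f x y : e (aut_invf f x) (aut_invf f y) = e x y.
Proof. by rewrite -(aut_adj f) !aut_invfK. Qed.

Definition aut_inv f : graph_aut :=
  @GraphAut (aut_invf f) (Bijective (aut_invfK f) (aut_funK f)) (aut_inv_adj f).

Lemma aut_mulA : associative aut_mul.
Proof. by move=> f g h; apply: graph_autP. Qed.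

Lemma aut_mul1 : left_id aut_one aut_mul.
Proof. by move=> f; apply: graph_autP. Qed.

Lemma aut_mulr1 : right_id aut_one aut_mul.
Proof. by move=> f; apply: graph_autP. Qed.

Lemma aut_mulV : left_inverse aut_one aut_inv aut_mul.
Proof. by move=> f; apply: graph_autP => x; apply: aut_funK. Qed.

Lemma aut_mulrV : right_inverse aut_one aut_inv aut_mul.
Proof. by move=> f; apply: graph_autP => x; apply: aut_invfK. Qed.

HB.instance Definition _ := isGroup.Build graph_aut
  aut_mulA aut_mul1 aut_mulr1 aut_mulV aut_mulrV.

(* The permutation topology: pointwise convergence on the discrete set [V]. *)
Definition aut_embed (g : graph_aut) : {ptws V -> discrete_topology V} :=
  aut_fun g.

HB.instance Definition _ :=
  Topological.copy graph_aut (initial_topology aut_embed).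

Lemma nbhs_aut1 g x : nbhs g [set h : graph_aut | h x = g x].
Proof.
have ev : (fun k : {ptws V -> discrete_topology V} => k x) @ aut_embed g
    --> (g x : discrete_topology V).
  have /cvg_sup/(_ x) cv : aut_embed g --> aut_embed g by apply: cvg_id.
  apply: cvg_trans; first exact: (cvg_app _ cv).
  exact: (@initial_continuous {ptws V -> discrete_topology V}
    (discrete_topology V) (fun k => k x) (aut_embed g)).
have em : aut_embed h @[h --> g] --> aut_embed g.
  exact: (@initial_continuous graph_aut _ aut_embed).
exact: (em _ (ev _ (discrete_set1 (g x : discrete_topology V)))).
Qed.

Lemma nbhs_autP g (B : set graph_aut) :
  nbhs g B <-> exists s : seq V, [set h : graph_aut | {in s, h =1 g}] `<=` B.
Proof.
split=> [|[s sB]]; last first.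
  apply: filterS sB _; elim: s => [|x s IHs].
    by apply: filterS (@filterT _ (nbhs g) _) => h _ x.
  apply: filterS (filterI (nbhs_aut1 g x) IHs) => h [hx hs] y.
  by rewrite inE => /predU1P[->|/hs].
pose N (s : seq V) := [set h : graph_aut | {in s, h =1 g}].
pose F := filter_from [set: seq V] N.
have FF : Filter F.
  apply: filter_fromT_filter; first by exists [::].
  move=> s t; exists (s ++ t) => h hst.
  by split=> x xs; apply: hst; rewrite mem_cat xs ?orbT.
have cv : aut_embed @ F --> aut_embed g.
  apply/cvg_sup => x U.
  have /= -> := @nbhsE (initial_topology
    (fun k : V -> discrete_topology V => k x)) (aut_embed g).
  move=> [C [[D _ <-] Dg] DU].
  exists [:: x] => // h /(_ x (mem_head _ _)) hx; apply: DU.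
  by rewrite /= /aut_embed hx.
rewrite nbhsE => -[C [[D oD <-] Dg] DB].
have /cv [s _ sD] : nbhs (aut_embed g) D by apply: open_nbhs_nbhs.
by exists s => h /sD /DB.
Qed.

Lemma closure_autP (A : set graph_aut) g :
  closure A g <-> forall s : seq V, exists2 h, A h & {in s, h =1 g}.
Proof.
split=> [clA s | Ag B /nbhs_autP[s sB]].
  have /clA [h [Ah hs]] : nbhs g [set h : graph_aut | {in s, h =1 g}].
    by apply/nbhs_autP; exists s.
  by exists h.
by have [h Ah hs] := Ag s; exists h; split=> //; apply: sB.
Qed.

End GraphAut.

Notation tree_aut m := (graph_aut (@cayley_adj m)).

Section CayleyTree.
Variable m : nat.

Lemma ltrans_bij (w : free_coxeter m) : bijective ( *%g w).
Proof. by exists ( *%g w^-1); [apply: mulKg | apply: mulVKg]. Qed.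

Lemma ltrans_adj (w x y : free_coxeter m) :
  cayley_adj (w * x) (w * y) = cayley_adj x y.
Proof.
by apply: eq_existsb => i; rewrite -mulgA (inj_eq (mulgI w)).
Qed.

Definition ltrans (w : free_coxeter m) : tree_aut m :=
  GraphAut (ltrans_bij w) (ltrans_adj w).

Definition coxeter_in_aut : set (tree_aut m) := range ltrans.

(* Two vertices lie in the same class of the canonical bipartition when their
   distances to [1] (i.e. the lengths of their reduced words) have the same
   parity. *)
Definition same_class (x y : free_coxeter m) : bool :=
  odd (size x) == odd (size y).

Lemma cayley_adj_class x y : cayley_adj x y -> ~~ same_class x y.
Proof.
have odd_lmul i s : odd (size (@cox_lmul m i s)) = ~~ odd (size s).
  by case: s => //= j s; case: eqP => /=; rewrite ?negbK.
have odd_mul s t : odd (size (@cox_mulw m s t)) = odd (size s) (+) odd (size t).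
  by elim: s => //= i s IHs; rewrite odd_lmul IHs addNb.
case/existsP => i /eqP ->; rewrite /same_class odd_mul /= addbT.
by case: (odd _).
Qed.

Definition aut_plus : set (tree_aut m) := [set g | forall x, same_class (g x) x].

End CayleyTree.

Arguments coxeter_in_aut : clear implicits.
Arguments aut_plus : clear implicits.

(* Main.v *)
Require Import Defs.
From mathcomp Require Import all_boot zify perm ssralg zmodp.
From mathcomp Require Import all_classical topology.

Set Implicit Arguments.
Unset Strict Implicit.
Unset Printing Implicit Defensive.

Local Open Scope classical_set_scope.
Local Open Scope group_scope.

(** Let [W] be the Coxeter group acting on its Cayley tree, [W+] its subgroup
    of elements of even length, [C] its commensurator and [M] the monolith of
    [C].  Colour the edge between [x] and [x * s_c] by the letter [c].  An
    automorphism of the tree lies in [W] when it preserves the colours, and in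
    [C] when its effect on the colours is periodic, that is, invariant under a
    finite index subgroup of [W].  Elements of [C] can thus be prescribed by
    finite data: given a finite right [W]-set with a point [q0] fixed by two
    letters [i] and [j], there is an involution [g] in [C] that fixes [1],
    exchanges the colours [i] and [j] at the vertices [x] with [q0 x = q0] and
    changes no colour at the other vertices ([twist]).  Taking for this [W]-set
    a finite subtree [X], in which a letter acts trivially when it leads out of
    [X], makes [g] fix [X] pointwise ([fold_twist]).

    The heart of the proof is a computation modulo a subgroup [N] of [C]
    normalised by enough elements and containing some [k <> 1] of [W].  Let [g]
    be the twist for a segment [X] of the tree from [1] through [k].  If the
    letters [i] and [j] point away from [X], then [g] conjugates [s_i] into
    [s_j] but centralises the conjugate [k s_i k^-1], which is congruent to
    [s_i] because [k] is in [N].  Hence [s_i] and [s_j] are congruent modulo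
    [N], and in the end all generators are, so that [N] contains [W+]
    ([gen_pair_in_normalized], [even_in_normalized]).  When only conjugation by
    elements of [M] is permitted, [g] is replaced by the commutator
    [g k^-1 g k], which is in [M] and has the same effect.

    A non-trivial [N] normalised by [W+] does meet [W] ([meets_coxeter]): for
    [n] in [N] and [w] in a finite index subgroup of [W+], the commutator of [n]
    and [w] is in both, and if all of these vanish then [n] has bounded
    displacement, which only the identity has.  So every non-trivial normal
    subgroup of [C] contains [W+], hence [M] does; and so does every non-trivial
    normal subgroup of [M], which yields simplicity because the intersection of
    the [C]-conjugates of such a subgroup is then non-trivial.

    For the closure, the commutators [g k^-1 g k] with [k] long act on a large
    ball as the exchange of two branches at one vertex ([monolith_swap]), and an
    element of [W+] followed by finitely many such exchanges agrees with a given
    type-preserving automorphism on any finite set.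

    Finally, if [M] were finitely generated then for every large prime [p], all
    [h] in [M] and all [w] in [W], some power of [w] with exponent prime to [p]
    would be conjugated into [W] by [h]: a generator gives exponents bounded by
    an index, and exponents multiply along products.  The conjugates of [W+] by
    the twist associated with a transitive dihedral action on [p] points are in
    [M] and violate this ([dihedral_twist_rotation]). *)

(** * Reduced words *)

Section Words.
Variable m : nat.
Implicit Types (a b c d : 'I_m) (s t : seq 'I_m) (x y z w : free_coxeter m).

Local Notation gen := (@cox_gen m).

Definition word s : free_coxeter m := \prod_(c <- s) gen c.

Lemma word_nil : word [::] = 1.
Proof. exact: big_nil. Qed.

Lemma word_cons c s : word (c :: s) = gen c * word s.
Proof. exact: big_cons. Qed.

Lemma word_cat s t : word (s ++ t) = word s * word t.
Proof. exact: big_cat. Qed.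

Lemma word1 c : word [:: c] = gen c.
Proof. exact: big_seq1. Qed.

Lemma word_rcons s c : word (rcons s c) = word s * gen c.
Proof. by rewrite -cats1 word_cat word1. Qed.

Lemma gen_inv c : (gen c)^-1 = gen c.
Proof. exact/mulg1_eq/cox_genK. Qed.

Lemma genKr x c : x * gen c * gen c = x.
Proof. by rewrite -mulgA cox_genK mulg1. Qed.

Lemma gen_inj : injective gen.
Proof. by move=> c d []. Qed.

Lemma cox_word_word s : reduced s -> cox_word (word s) = s.
Proof.
elim: s => [|c s IHs] rs; first by rewrite word_nil.
rewrite word_cons /= IHs; last exact: path_sorted rs.
by case: s rs {IHs} => //= d s /andP[/negbTE ->].
Qed.

Lemma wordK x : word (cox_word x) = x.
Proof. exact/val_inj/cox_word_word/cox_reduced. Qed.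

Lemma reduced_catl s t : reduced (s ++ t) -> reduced s.
Proof.
by rewrite /reduced; case: s => //= c s; rewrite cat_path => /andP[].
Qed.

Lemma reduced_rconsl s c : reduced (rcons s c) -> reduced s.
Proof. by rewrite -cats1; apply: reduced_catl. Qed.
Lemma reduced_cat2 s c d t :
  reduced (rcons s c ++ d :: t) =
    [&& reduced (rcons s c), c != d & reduced (d :: t)].
Proof.
rewrite /reduced; case: s => [|b s] //=.
by rewrite cat_path last_rcons /=.
Qed.

Lemma reduced_rcons2 s c d :
  reduced (rcons (rcons s c) d) = reduced (rcons s c) && (c != d).
Proof. by rewrite -(cats1 (rcons s c)) reduced_cat2 andbT. Qed.

Lemma reduced_word_rcons x c :
  reduced (rcons x c) -> cox_word (x * gen c) = rcons x c.
Proof. by move=> rxc; rewrite -{1}(wordK x) -word_rcons cox_word_word. Qed.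

Lemma word_genP x c :
  (reduced (rcons x c) /\ cox_word (x * gen c) = rcons x c) \/
  cox_word x = rcons (x * gen c) c.
Proof.
have rx := cox_reduced x; case/lastP Ex: (cox_word x) => [|s d].
  by left; rewrite -Ex; split; rewrite ?reduced_word_rcons // Ex.
rewrite Ex in rx; have [dc|ndc] := eqVneq d c.
  right; congr rcons; last by [].
  rewrite -(wordK x) Ex word_rcons dc genKr cox_word_word //.
  by move: rx; rewrite -cats1; apply: reduced_catl.
have r : reduced (rcons x c) by rewrite Ex reduced_rcons2 rx.
by left; rewrite -Ex; split=> //; apply: reduced_word_rcons.
Qed.

Lemma odd_size_gen x c : odd (size (x * gen c)) = ~~ odd (size x).
Proof.
by case: (word_genP x c) => [[_ ->]|->]; rewrite size_rcons //= negbK.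
Qed.

Lemma odd_sizeM x y : odd (size (x * y)) = odd (size x) (+) odd (size y).
Proof.
rewrite -(wordK y) cox_word_word; last exact: cox_reduced.
elim/last_ind: (cox_word y) => [|s c IHs].
  by rewrite word_nil mulg1 addbF.
by rewrite word_rcons mulgA odd_size_gen IHs size_rcons /= addbN.
Qed.

Lemma size_eq1 x : size x = 0 -> x = 1.
Proof. by move=> /size0nil x0; apply: val_inj. Qed.

Lemma odd_sizeV x : odd (size x^-1) = odd (size x).
Proof. by have := odd_sizeM x^-1 x; rewrite mulVg /=; do 2!case: odd. Qed.

Lemma size_gen x c :
  size x <= (size (x * gen c)).+1 /\ size (x * gen c) <= (size x).+1.
Proof.
by case: (word_genP x c) => [[_ ->]|->]; rewrite size_rcons; split=> //;
  rewrite ltnW.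
Qed.

Lemma size_mul x y : size (x * y)%g <= size x + size y.
Proof.
rewrite -(wordK y) cox_word_word; last exact: cox_reduced.
elim/last_ind: (cox_word y) => [|s c IHs].
  by rewrite word_nil mulg1 addn0.
rewrite word_rcons mulgA size_rcons addnS.
exact: leq_trans (size_gen _ _).2 _.
Qed.

Lemma size_inv x : size x^-1 = size x.
Proof. exact: size_rev. Qed.

(** Cancellation in the product of [x] by a shorter element cannot reach the
    first letter of [x]. *)
Lemma ohead_mul x y : size y < size x -> ohead (x * y) = ohead x.
Proof.
rewrite -[y in x * y]wordK; elim: (cox_word y) x => [|c s IHs] x.
  by rewrite word_nil mulg1.
move=> lt_s; rewrite word_cons mulgA IHs; last first.
  by rewrite -ltnS (leq_trans lt_s) // (size_gen x c).1.
case: (word_genP x c) => [[_ ->]|xE]; first by case: (cox_word x) lt_s.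
have : 0 < size (x * gen c).
  by rewrite -ltnS (leq_trans _ (size_gen x c).1) // (leq_trans _ lt_s).
by rewrite [in RHS]xE; case: (cox_word (x * gen c)).
Qed.

Lemma alternating_word a b n : a != b ->
  cox_word ((gen a * gen b) ^+ n) = flatten (nseq n [:: a; b]).
Proof.
move=> ab; pose t := flatten (nseq n [:: a; b]).
have rt : reduced t.
  have rab : reduced (rcons [:: a] b) by rewrite /reduced /= ab.
  rewrite /t; elim: n {t} => [//|[//|n] IHn].
  have -> : flatten (nseq n.+2 [:: a; b]) =
      rcons [:: a] b ++ a :: b :: flatten (nseq n [:: a; b]) by [].
  by rewrite reduced_cat2 rab eq_sym ab; apply: IHn.
have -> : (gen a * gen b) ^+ n = word t.
  rewrite /t; elim: n {t rt} => [|n IHn]; first by rewrite word_nil.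
  by rewrite expgS IHn /= !word_cons mulgA.
exact: cox_word_word.
Qed.

Fixpoint ball n : seq (free_coxeter m) :=
  if n is n'.+1 then ball n' ++ [seq x * gen c | x <- ball n', c <- enum 'I_m]
  else [:: 1].

Lemma ball_mem n x : size x <= n -> x \in ball n.
Proof.
elim: n x => [|n IHn] x; first by rewrite leqn0 => /eqP/size_eq1->; rewrite inE.
rewrite leq_eqVlt => /orP[/eqP|]; last by rewrite mem_cat ltnS => /IHn ->.
case/lastP E: (cox_word x) => [//|s c]; rewrite size_rcons => -[sn].
rewrite mem_cat; apply/orP; right.
have rs : reduced s.
  by have := cox_reduced x; rewrite E -cats1; apply: reduced_catl.
apply/allpairsP; exists (word s, c); split; rewrite ?mem_enum //=.
  by apply: IHn; rewrite cox_word_word // sn.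
by rewrite -word_rcons -E wordK.
Qed.

Lemma free_coxeter_ind (P : free_coxeter m -> Prop) :
  P 1 -> (forall x c, P x -> P (x * gen c)) -> forall x, P x.
Proof.
move=> P1 PM x; rewrite -(wordK x); elim/last_ind: (cox_word x) => [|s c IHs].
  by rewrite word_nil.
by rewrite word_rcons; apply: PM.
Qed.

Lemma avoid2 a b : 2 < m -> exists c, c != a /\ c != b.
Proof.
move=> hm; case: (pickP [pred c | (c != a) && (c != b)]) => [c /andP[]|P0].
  by exists c.
have : #|'I_m| <= #|[set a; b]%SET|.
  apply/subset_leq_card/fintype.subsetP => c _; rewrite !inE.
  by have := P0 c; rewrite /= -negb_or => /negbFE.
by rewrite card_ord cards2 leqNgt (leq_ltn_trans _ hm) //; case: (a != b).
Qed.

End Words.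

(** * The commensurator of the Coxeter group *)
Section Commensurator.
Variable m : nat.
Implicit Types (c d : 'I_m) (x y z w : free_coxeter m) (g h k : tree_aut m).

Local Notation gen := (@cox_gen m).
Local Notation W := (coxeter_in_aut m).
Local Notation C := (commensurator W).

Lemma autE g h x : (g * h) x = g (h x).
Proof. by []. Qed.

Lemma autK g x : g^-1 (g x) = x.
Proof. exact: aut_funK. Qed.

Lemma autVK g x : g (g^-1 x) = x.
Proof. exact: aut_invfK. Qed.

Lemma aut_inj g : injective g.
Proof. exact: can_inj (autK g). Qed.

Lemma ltransE w x : ltrans w x = w * x.
Proof. by []. Qed.

Lemma ltransM x y : ltrans (x * y) = ltrans x * ltrans y.
Proof. by apply: graph_autP => z; rewrite autE !ltransE mulgA. Qed.

Lemma ltrans1 : ltrans (1 : free_coxeter m) = 1.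
Proof. by apply: graph_autP => z; rewrite ltransE mul1g. Qed.

Lemma ltransV x : ltrans x^-1 = (ltrans x)^-1.
Proof. by apply/esym/mulg1_eq; rewrite -ltransM mulgV ltrans1. Qed.

Lemma ltransX x n : ltrans (x ^+ n) = ltrans x ^+ n.
Proof.
by elim: n => [|n IHn]; rewrite ?expg0 ?ltrans1 // !expgS ltransM IHn.
Qed.

Lemma ltrans_inj : injective (@ltrans m).
Proof.
move=> x y /(congr1 (fun g : tree_aut m => g 1)).
by rewrite !ltransE !mulg1.
Qed.

Lemma aut_gen g x c : exists d, g (x * gen c) = g x * gen d.
Proof.
have /existsP[d /eqP gd] : cayley_adj (g x) (g (x * gen c)).
  by rewrite aut_adj; apply/existsP; exists c.
by exists d.
Qed.

(** As the right multiplications by generators are the coloured edges of the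
    tree, [W] is the group of colour-preserving automorphisms. *)
Lemma cox_autP g : W g <-> forall x c, g (x * gen c) = g x * gen c.
Proof.
split=> [[w _ <-] x c|gc]; first by rewrite !ltransE mulgA.
exists (g 1) => //; apply: graph_autP => x; rewrite ltransE.
elim/free_coxeter_ind: x => [|x c IHx]; first by rewrite mulg1.
by rewrite gc mulgA IHx.
Qed.

Lemma cox_aut_ltrans g : W g -> g = ltrans (g 1).
Proof. by case=> w _ <-; rewrite ltransE mulg1. Qed.

Lemma cox_autM g h : W g -> W h -> W (g * h).
Proof. by case=> x _ <- [y _ <-]; exists (x * y) => //; rewrite ltransM. Qed.

Lemma cox_autV g : W g -> W g^-1.
Proof. by case=> x _ <-; exists x^-1 => //; rewrite ltransV. Qed.

(** For [w] in the Coxeter group, membership in the conjugate of [W] by [g]; see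
    [in_conjE]. *)
Definition in_conj g w : Prop := W (g^-1 * ltrans w * g).

Lemma in_conjM g w x :
  in_conj g w -> in_conj g x -> in_conj g (w * x).
Proof.
move=> gw gx; rewrite /in_conj ltransM.
by have := cox_autM gw gx; rewrite !mulgA mulgK.
Qed.

Lemma in_conjX g w n : in_conj g w -> in_conj g (w ^+ n).
Proof.
move=> gw; elim: n => [|n IHn]; last by rewrite expgS; apply: in_conjM.
rewrite expg0 /in_conj ltrans1 mulg1 mulVg.
by exists 1 => //; rewrite ltrans1.
Qed.

Lemma lcoset_inv_eq (H : set (tree_aut m)) (x y : tree_aut m) :
  is_subgroup H -> (lcoset_set H x^-1 = lcoset_set H y^-1) <-> H (x * y^-1).
Proof.
move=> /is_subgroupP[H1 HM HV]; split=> [xy | Hxy].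
  have : lcoset_set H y^-1 y^-1 by exists 1; rewrite ?mulg1.
  by rewrite -xy => -[h Hh <-]; rewrite mulVKg.
apply/seteqP; split=> _ [h Hh <-].
  by exists (y * x^-1 * h); [apply: HM => //; rewrite -invgF; apply: HV
    | rewrite -mulgA mulKg].
by exists (x * y^-1 * h); [apply: HM | rewrite -mulgA mulKg].
Qed.

Lemma cox_aut_subgroup : is_subgroup W.
Proof.
apply/is_subgroupP; split; [|exact: cox_autM|exact: cox_autV].
by exists 1 => //; rewrite ltrans1.
Qed.

Lemma commensurated_subgroup g : is_subgroup (W `&` conj_set g W).
Proof.
have /is_subgroupP[W1 WM WV] := cox_aut_subgroup.
apply/is_subgroupP; split.
- by split=> //; exists 1; rewrite ?mulg1 ?mulgV.
- move=> u v [Wu [x Wx uE]] [Wv [y Wy vE]]; split; first exact: WM.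
  rewrite -uE -vE; by exists (x * y); [apply: WM | rewrite !mulgA mulgVK].
- move=> u [Wu [x Wx uE]]; split; first exact: WV.
  rewrite -uE; by exists x^-1; [apply: WV | rewrite !invgM invgK mulgA].
Qed.

Lemma in_conjE g w : (W `&` conj_set g W) (ltrans w) <-> in_conj g w.
Proof.
split=> [[_ [h Wh gh]] | gw].
  by rewrite /in_conj -gh !mulgA mulVg mul1g mulgVK.
split; first by exists w.
by exists (g^-1 * ltrans w * g) => //; rewrite !mulgA mulgV mul1g mulgK.
Qed.

(** Finiteness of the index expressed by a finite-valued function whose fibres
    lie in single cosets.  In this form the intersection of two finite index
    subgroups only needs a pair of functions. *)
Lemma commensurator_finP g :
  C g <-> exists (P : finType) (f : free_coxeter m -> P),
            forall x y, f x = f y -> in_conj g (x * y^-1).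
Proof.
set H := W `&` conj_set g W.
have HE x y : lcoset_set H (ltrans x^-1) = lcoset_set H (ltrans y^-1) <->
    in_conj g (x * y^-1).
  rewrite !ltransV; apply: iff_trans; last exact: in_conjE.
  rewrite ltransM ltransV; exact/lcoset_inv_eq/commensurated_subgroup.
split=> [/finite_seqP[s sE] | [P [f fP]]].
  have sx x : lcoset_set H (ltrans x^-1) \in s.
    suff : [set` s] (lcoset_set H (ltrans x^-1)) by [].
    by rewrite -sE; exists (ltrans x^-1) => //; exists x^-1.
  exists (seq_sub s), (fun x => SeqSub (sx x)) => x y [] xy.
  exact/HE.
pose rep (p : P) := xget 1 [set x | f x = p].
have repE x : f (rep (f x)) = f x.
  by rewrite /rep; case: xgetP => // /(_ x) [].
pose coset p := lcoset_set H (ltrans (rep p)^-1).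
apply: (sub_finite_set (B := range coset)).
  move=> _ [_ [x _ <-] <-]; exists (f x^-1) => //.
  by rewrite -[in RHS](invgK x); apply/HE/fP.
exact: finite_image.
Qed.

(** A finite index subgroup of [W] is one with finitely many orbits of vertices,
    since [W] is simply transitive on them.  This property is preserved when a
    subgroup and the tree are moved by [g]: a function [f] as in
    [commensurator_finP] is moved to [f \o g]. *)
Lemma commensuratorV g : C g -> C g^-1.
Proof.
move=> /commensurator_finP[P [f fP]]; apply/commensurator_finP.
exists P, (f \o g) => x y /fP; set w := _ * _ => gw.
have wy : w * g y = g x by rewrite /w mulgVK.
have E : g^-1 * ltrans w * g = ltrans (x * y^-1).
  rewrite (cox_aut_ltrans gw); congr ltrans.
  rewrite -[LHS](mulgK y); congr (_ / _).
  rewrite -!ltransE -cox_aut_ltrans // !autE ltransE wy autK //.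
by rewrite /in_conj -E invgK !mulgA mulgV mul1g mulgK; exists w.
Qed.

Lemma commensuratorM g h : C g -> C h -> C (g * h).
Proof.
move=> /commensurator_finP[P [f fP]] /commensurator_finP[Q [f' fQ]].
apply/commensurator_finP.
exists (P * Q)%type, (fun x => (f x, f' (g^-1 x))) => x y [/fP gw /fQ hw].
rewrite /in_conj invgM -!mulgA; rewrite !(mulgA _ _ (_ * _)).
have E : g^-1 * ltrans (x * y^-1) * g = ltrans (g^-1 x * (g^-1 y)^-1).
  rewrite (cox_aut_ltrans gw); congr ltrans.
  rewrite -[LHS](mulgK (g^-1 y)); congr (_ / _).
  by rewrite -!ltransE -cox_aut_ltrans // !autE autVK ltransE mulgVK.
by move: hw; rewrite /in_conj -E !mulgA.
Qed.

Lemma ltrans_commensurates w : C (ltrans w).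
Proof.
apply/commensurator_finP; exists unit, (fun=> tt) => x y _.
by rewrite /in_conj; do 2?apply: cox_autM; rewrite -?ltransV; eexists.
Qed.

Lemma commensurator_subgroup : is_subgroup C.
Proof.
apply/is_subgroupP; split=> [|x y|x].
- by rewrite -ltrans1; apply: ltrans_commensurates.
- exact: commensuratorM.
- exact: commensuratorV.
Qed.

(** The bound on the exponents is uniform in [w]: among the powers of [w] up to
    the size of the finite type, two have the same value. *)
Lemma commensurator_pow g : C g ->
  exists N, forall w, exists2 e, 0 < e <= N & in_conj g (w ^+ e).
Proof.
move=> /commensurator_finP[P [f fP]]; exists #|P| => w.
have /injectivePn[i [j ij fij]] :
    ~~ injectiveb (fun i : 'I_#|P|.+1 => f (w ^+ i)).
  apply/injectiveP => /leq_card; by rewrite card_ord ltnn.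
wlog lt_ji : i j ij fij / j < i.
  move=> IH; have := ij; rewrite neq_ltn => /orP[lij|]; last exact: IH.
  by apply: (IH j i) => //; rewrite eq_sym.
exists (i - j).
  by rewrite subn_gt0 lt_ji (leq_trans (leq_subr _ _)) // -ltnS.
by rewrite expgnFr; [apply: fP | apply: ltnW].
Qed.

End Commensurator.

(** * Twists *)

(** A right action of the Coxeter group is given by one involution for each
    letter. *)
Section RightAction.
Variables (m : nat) (P : Type) (step : P -> 'I_m -> P).
Hypothesis stepK : forall p c, step (step p c) c = p.
Implicit Types (c : 'I_m) (p : P) (x y : free_coxeter m).

Definition act p x : P := foldl step p x.

Lemma act_gen p c : act p (cox_gen c) = step p c.
Proof. by []. Qed.

Lemma actM p x y : act p (x * y) = act (act p x) y.
Proof.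
have actl c s q : foldl step q (cox_lmul c s) = foldl step (step q c) s.
  by case: s => //= d s; case: eqP => //= ->; rewrite stepK.
rewrite /act /=; elim: (cox_word x) p => //= c s IHs p.
by rewrite actl IHs.
Qed.

Lemma actK p x : act (act p x) x^-1 = p.
Proof. by rewrite -actM mulgV. Qed.

Lemma act_inj x : injective (act ^~ x).
Proof. exact: (can_inj (g := act ^~ x^-1)) (actK ^~ x). Qed.

End RightAction.

Section Twist.
Variables (m : nat) (P : finType) (step : P -> 'I_m -> P) (q0 : P) (i j : 'I_m).
Hypothesis stepK : forall p c, step (step p c) c = p.
Hypotheses (q0i : step q0 i = q0) (q0j : step q0 j = q0).
Implicit Types (c d : 'I_m) (p : P) (x y w : free_coxeter m).

Local Notation gen := (@cox_gen m).
Local Notation W := (coxeter_in_aut m).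
Local Notation C := (commensurator W).

(** The change of colours made by the twist at a vertex of state [p]. *)
Definition relabel p c : 'I_m := if p == q0 then tperm i j c else c.

Lemma relabelK p : involutive (relabel p).
Proof. by move=> c; rewrite /relabel; case: eqP => // _; rewrite tpermK. Qed.

(** The two ends of an edge agree about its new colour: an edge that leads from
    the state [q0] to another state has a colour other than [i] and [j]. *)
Lemma relabel_step p c : relabel (step p c) c = relabel p c.
Proof.
have q0P : step q0 c = q0 \/ tperm i j c = c.
  by case: tpermP => [->|->|_ _]; [left|left|right].
rewrite /relabel; case: (eqVneq p q0) => [->|np].
  by case: q0P => ->; rewrite ?eqxx //; case: ifP.
case: eqP => // pq; case: q0P => // E.
by rewrite -(stepK p c) pq E eqxx in np.
Qed.

Lemma step_relabel p c : step p (relabel p c) = step p c.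
Proof.
rewrite /relabel; case: eqP => // ->.
by case: tpermP => [->|->|_ _]; rewrite ?q0i ?q0j.
Qed.

(* The skew product of the action on states with the relabelled right
   translations.  It is again a right action, so that the second component of
   the orbit of [(p, 1)] is a well defined function of group elements. *)
Let skew (p : P * free_coxeter m) c := (step p.1 c, p.2 * gen (relabel p.1 c)).

Lemma skewK (p : P * free_coxeter m) c : skew (skew p c) c = p.
Proof. by case: p => p x; rewrite /skew /= stepK relabel_step genKr. Qed.

(** The cocycle that relabels the path spelled by [x] started in state [p]. *)
Definition twist_from p x : free_coxeter m := (act skew (p, 1) x).2.

Lemma act_skew p x y : act skew (p, x) y = (act step p y, x * twist_from p y).
Proof.
rewrite /twist_from /act; elim/last_ind: (cox_word y) x => [|s c IHs] x /=.
  by rewrite mulg1.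
have E : (foldl skew (p, 1) s).1 = foldl step p s by rewrite IHs.
by rewrite !foldl_rcons IHs /skew /= E mulgA.
Qed.

Lemma twist_fromM p x y :
  twist_from p (x * y) = twist_from p x * twist_from (act step p x) y.
Proof.
by rewrite {1}/twist_from actM; [rewrite !act_skew mul1g | exact: skewK].
Qed.

Lemma twist_from_gen p c : twist_from p (gen c) = gen (relabel p c).
Proof. by rewrite /twist_from act_gen /= mul1g. Qed.

Lemma twist_fromV p x :
  twist_from (act step p x) x^-1 = (twist_from p x)^-1.
Proof. by apply/esym/mulg1_eq; rewrite -twist_fromM mulgV. Qed.

Lemma twist_from_genr p x c :
  twist_from p (x * gen c) = twist_from p x * gen (relabel (act step p x) c).
Proof. by rewrite twist_fromM twist_from_gen. Qed.

(** The letters [i] and [j] act alike on every state where they are exchanged,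
    so that a relabelled path visits the same states.  This makes the twist an
    involution. *)
Lemma act_twist_from p x : act step p (twist_from p x) = act step p x.
Proof.
elim/free_coxeter_ind: x => [//|x c IHx].
by rewrite twist_from_genr !actM // !act_gen IHx step_relabel.
Qed.

Lemma twist_fromK p : involutive (twist_from p).
Proof.
elim/free_coxeter_ind => [//|x c IHx].
by rewrite !twist_from_genr IHx act_twist_from relabelK.
Qed.

Lemma twist_adj x y :
  cayley_adj (twist_from q0 x) (twist_from q0 y) = cayley_adj x y.
Proof.
have tw u v : cayley_adj u v -> cayley_adj (twist_from q0 u) (twist_from q0 v).
  case/existsP=> c /eqP ->; apply/existsP.
  by exists (relabel (act step q0 u) c); rewrite twist_from_genr.
by apply/idP/idP => [/tw|/tw//]; rewrite !twist_fromK.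
Qed.

Definition twist : tree_aut m := GraphAut (inv_bij (twist_fromK q0)) twist_adj.

Lemma twist_gen x c :
  twist (x * gen c) = twist x * gen (relabel (act step q0 x) c).
Proof. exact: twist_from_genr. Qed.

Lemma twist_at1 : twist 1 = 1.
Proof. by []. Qed.

Lemma twistK : involutive twist.
Proof. exact: twist_fromK. Qed.

Lemma twist_sqr : twist * twist = 1.
Proof. by apply: graph_autP => x; rewrite autE twistK. Qed.

Lemma twist_inv : twist^-1 = twist.
Proof. exact/mulg1_eq/twist_sqr. Qed.

Lemma act_twist x : act step q0 (twist x) = act step q0 x.
Proof. exact: act_twist_from. Qed.

(** Left translation by the stabiliser of [q0] preserves states, hence the
    relabelling. *)
Lemma conj_twist w :
  act step q0 w = q0 -> twist * ltrans w * twist = ltrans (twist w).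
Proof.
move=> qw.
have Wt : W (twist * ltrans w * twist).
  apply/cox_autP => x c; rewrite !autE !ltransE twist_gen mulgA twist_gen.
  by rewrite actM // qw act_twist relabelK.
by rewrite (cox_aut_ltrans Wt) !autE ltransE twist_at1 mulg1.
Qed.

Lemma twist_commensurates : C twist.
Proof.
apply/commensurator_finP; exists P, (act step q0) => x y qxy.
rewrite /in_conj twist_inv conj_twist; first by eexists.
by rewrite actM // qxy actK.
Qed.

(** The reflection in the edge of colour [c] at [k]: the path from [1] along
    [k], across that edge and back is not relabelled on the outward journey, and
    the way back undoes it because the state after the edge is the state
    before. *)
Lemma twist_fix_conj k c :
  twist k = k -> act step q0 k != q0 ->
  step (act step q0 k) c = act step q0 k ->
  twist * ltrans (k * gen c * k^-1) * twist = ltrans (k * gen c * k^-1).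
Proof.
move=> tk nk kc.
have kcE : act step q0 (k * gen c) = act step q0 k by rewrite actM.
rewrite conj_twist; last by rewrite actM // kcE actK.
congr ltrans; rewrite /= twist_fromM kcE twist_fromV twist_from_genr.
by rewrite [twist_from _ k]tk /relabel (negbTE nk).
Qed.

Lemma conj_twist_gen : twist * ltrans (gen i) * twist = ltrans (gen j).
Proof. by rewrite conj_twist // /= twist_from_gen /relabel eqxx tpermL. Qed.

End Twist.

(** * Rooted subtrees *)
Section Subtrees.
Variable m : nat.
Implicit Types (c e : 'I_m) (s t : seq 'I_m) (x z v : free_coxeter m).

Local Notation gen := (@cox_gen m).

Lemma reduced_join s e t :
  reduced (rcons s e) -> reduced (e :: t) -> reduced (s ++ e :: t).
Proof.
case/lastP: s => [//|s d]; rewrite reduced_rcons2 => /andP[rs de] ret.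
by rewrite reduced_cat2 rs de.
Qed.

(** The finite subtrees of the Cayley tree that contain [1], as sets of words
    closed under prefixes. *)
Definition rooted_subtree (X : seq (free_coxeter m)) : Prop :=
  1 \in X /\ forall x c, reduced (rcons x c) -> x * gen c \in X -> x \in X.

Lemma rooted_prefix X s t :
  rooted_subtree X -> reduced (s ++ t) -> word (s ++ t) \in X -> word s \in X.
Proof.
move=> [_ Xcl]; elim/last_ind: t => [|t c IHt]; first by rewrite cats0.
rewrite -rcons_cat => r; have r' : reduced (s ++ t).
  by move: r; rewrite -cats1; apply: reduced_catl.
by rewrite word_rcons => /Xcl; rewrite cox_word_word // => /(_ r); apply: IHt.
Qed.

(** Convexity: the first edge of the geodesic from [v] to [z] stays in a subtree
    containing both. *)
Lemma rooted_convex X v z e : rooted_subtree X -> v \in X -> z \in X ->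
  ohead (v^-1 * z) = Some e -> v * gen e \in X.
Proof.
move=> XX vX zX; case E: (cox_word (v^-1 * z)) => [//|e' t] /= [e'e].
rewrite e'e in E.
have [[rve veE]|vE] := word_genP v e; last first.
  apply: (XX.2 _ e); last by rewrite genKr.
  by rewrite -vE; apply: cox_reduced.
have ret : reduced (e :: t) by rewrite -E; apply: cox_reduced.
have zE : z = word (rcons v e ++ t).
  by rewrite cat_rcons word_cat -E !wordK mulVKg.
rewrite -[v * gen e]wordK veE; apply: (rooted_prefix (t := t) XX).
  by rewrite cat_rcons reduced_join.
by rewrite -zE.
Qed.

Definition prefixes t : seq (free_coxeter m) :=
  [seq word (take n t) | n <- iota 0 (size t).+1].

Lemma mem_prefixes t x :
  reduced t -> (x \in prefixes t) = prefix (cox_word x) t.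
Proof.
move=> rt; apply/mapP/idP => [[n _ ->]|xt].
  rewrite cox_word_word ?prefix_take //.
  by apply: (@reduced_catl _ _ (drop n t)); rewrite cat_take_drop.
exists (size x); first by rewrite mem_iota ltnS size_prefix.
by move: xt; rewrite prefixE => /eqP ->; rewrite wordK.
Qed.

Lemma prefixes_rooted t : reduced t -> rooted_subtree (prefixes t).
Proof.
move=> rt; split=> [|x b]; rewrite !mem_prefixes //; first exact: prefix0s.
move=> /reduced_word_rcons ->; exact/prefix_trans/prefix_rcons.
Qed.

End Subtrees.

(** * Twists fixing a finite subtree *)
Section FoldTwist.
Variables (m : nat) (X : seq (free_coxeter m)) (i j : 'I_m).
Implicit Types (c : 'I_m) (x y w : free_coxeter m).
Local Notation gen := (@cox_gen m).

Hypothesis X_rooted : rooted_subtree X.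
Hypotheses (Xi : gen i \notin X) (Xj : gen j \notin X).

(** [insubd] makes a letter leading out of [X] act trivially.  The orbit map of
    [1] is the retraction that folds the tree onto [X] by reflections. *)
Definition fold_step (p : seq_sub X) c : seq_sub X := insubd p (val p * gen c).

Lemma val_fold_step p c :
  val (fold_step p c) = if val p * gen c \in X then val p * gen c else val p.
Proof. exact: val_insubd. Qed.

Lemma fold_stepK p c : fold_step (fold_step p c) c = p.
Proof.
apply: val_inj; rewrite !val_fold_step.
case E: (val p * gen c \in X); last by rewrite E.
by rewrite genKr (valP p).
Qed.

Definition fold_base : seq_sub X := SeqSub X_rooted.1.

Lemma fold_stop p c : val p * gen c \notin X -> fold_step p c = p.
Proof. by move=> npc; apply: val_inj; rewrite val_fold_step (negbTE npc). Qed.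

Lemma fold_base_i : fold_step fold_base i = fold_base.
Proof. by apply: fold_stop; rewrite mul1g. Qed.

Lemma fold_base_j : fold_step fold_base j = fold_base.
Proof. by apply: fold_stop; rewrite mul1g. Qed.

Lemma val_act_fold x : x \in X -> val (act fold_step fold_base x) = x.
Proof.
rewrite -(wordK x); have := cox_reduced x.
elim/last_ind: (cox_word x) => [|s c IHs] rs; first by rewrite word_nil.
have rs' : reduced s := reduced_rconsl rs.
have sE := cox_word_word rs'.
rewrite word_rcons => sX.
have sX' : word s \in X by apply: X_rooted.2 sX; rewrite sE.
by rewrite actM ?val_fold_step ?IHs ?sX //; apply: fold_stepK.
Qed.

Definition fold_twist : tree_aut m :=
  twist fold_stepK fold_base_i fold_base_j.

(** Away from [1] no vertex of [X] is in the base state, and the two letters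
    exchanged at [1] lead out of [X]. *)
Lemma fold_twist_fix x : x \in X -> fold_twist x = x.
Proof.
rewrite -(wordK x); have := cox_reduced x.
elim/last_ind: (cox_word x) => [|s c IHs] rs; first by rewrite word_nil.
have rs' : reduced s := reduced_rconsl rs.
have sE := cox_word_word rs'.
rewrite word_rcons => sX.
have sX' : word s \in X by apply: X_rooted.2 sX; rewrite sE.
rewrite /fold_twist twist_gen -/fold_twist IHs //; congr (_ * gen _).
rewrite /relabel; case: eqP => // /(congr1 val).
rewrite val_act_fold // => /= s1; rewrite s1 mul1g in sX.
by rewrite tpermD //; [apply: contraNneq Xi | apply: contraNneq Xj] => ->.
Qed.

Lemma act_fold_neq x :
  x \in X -> x != 1 -> act fold_step fold_base x != fold_base.
Proof.
move=> xX; apply: contra_neq => /(congr1 val).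
by rewrite val_act_fold.
Qed.

Lemma fold_twist_fix_conj k c : k \in X -> k != 1 -> k * gen c \notin X ->
  fold_twist * ltrans (k * gen c * k^-1) * fold_twist =
    ltrans (k * gen c * k^-1).
Proof.
move=> kX k1 kcX; apply: twist_fix_conj; first exact: fold_twist_fix.
  exact: act_fold_neq.
by apply: fold_stop; rewrite val_act_fold.
Qed.

Lemma fold_twist_commensurates : commensurator (coxeter_in_aut m) fold_twist.
Proof. exact: twist_commensurates. Qed.

End FoldTwist.

(** * Subgroups normalised by a part of the commensurator *)
Definition normalized_by (G : groupType) (A N : set G) : Prop :=
  forall g x, A g -> N x -> N (g * x * g^-1).

Section Core.
Variable m : nat.
Hypothesis hm : 2 < m.
Implicit Types (a b c d i j : 'I_m) (s : seq 'I_m) (x y z w : free_coxeter m).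
Implicit Types (g h k : tree_aut m) (M N : set (tree_aut m)).

Local Notation gen := (@cox_gen m).
Local Notation W := (coxeter_in_aut m).
Local Notation C := (commensurator W).

Definition even_coxeter : set (tree_aut m) :=
  [set ltrans w | w in [set w : free_coxeter m | ~~ odd (size w)]].

Lemma even_gen2 a b : even_coxeter (ltrans (gen a * gen b)).
Proof.
have ev : ~~ odd (size (gen a * gen b)) by rewrite odd_sizeM.
by exists (gen a * gen b).
Qed.

(** Leaving [x] through an edge that does not point to [g x], and whose image
    does not point back to [x], increases the displacement by 2.  Each of the
    two conditions excludes at most one of the [m] edges at [x]. *)
Lemma displacement_grows g x :
  g x != x ->
  exists y, size (y^-1 * g y) = (size (x^-1 * g x)).+2.
Proof.
move=> gx; set u := x^-1 * g x.
have u1 : u != 1.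
  by apply: contraNneq gx => u1; rewrite -(mulVKg x (g x)) -/u u1 mulg1.
case/lastP Eu: (cox_word u) => [|s b].
  by case/eqP: u1; rewrite -(wordK u) Eu word_nil.
have ru := cox_reduced u; rewrite Eu in ru.
(* At most one letter [b'] has its edge sent to the edge pointing back. *)
have [b' b'P] : exists b', forall c, g (x * gen c) = g x * gen b -> c = b'.
  have [[b' gb']|nb] := pselect (exists b', g (x * gen b') = g x * gen b).
    exists b' => c; rewrite -gb' => /aut_inj/mulgI/gen_inj; exact: id.
  by exists b => c gc; case: nb; exists c.
have [c [ca cb]] := avoid2 (head b s) b' hm.
have [d gd] := aut_gen g x c.
have bd : b != d by apply: contra_neq cb => bd; apply: b'P; rewrite gd bd.
exists (x * gen c); rewrite gd.
have -> : (x * gen c)^-1 * (g x * gen d) = word (c :: rcons (rcons s b) d).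
  by rewrite word_cons word_rcons -Eu wordK /u invgM gen_inv !mulgA.
rewrite cox_word_word; first by rewrite /= !size_rcons.
rewrite /reduced /=; move: ru ca {Eu}; case: s => [|a s] /=.
  by move=> _ ->; rewrite bd.
by move=> r ->; rewrite rcons_path r last_rcons.
Qed.

Lemma bounded_displacement g n :
  (forall x, size (x^-1 * g x) <= n) -> g = 1.
Proof.
move=> gn; apply: graph_autP => x; apply: contrapT => /eqP gx.
suff grow (r : nat) : exists y, r < size (y^-1 * g y).
  by have [y] := grow n; rewrite ltnNge gn.
elim: r => [|r [y yk]].
  have [y yE] := displacement_grows gx; by exists y; rewrite yE.
have gy : g y != y by apply: contraTneq yk => ->; rewrite mulVg.
by have [z zE] := displacement_grows gy; exists z; rewrite zE; lia.
Qed.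

(** For [n] in [N], the commutators of [n] with the even elements that [n]
    conjugates into [W] lie in both [N] and [W].  If they are all trivial, the
    displacement of [n] takes finitely many values, one for each value of
    [f2]. *)
Lemma meets_coxeter N : is_subgroup N -> N `<=` C -> N <> [set 1] ->
  normalized_by even_coxeter N -> exists2 w, w != 1 & N (ltrans w).
Proof.
move=> /is_subgroupP[N1 NM NV] NC Nn1 Nev.
have [n [Nn n1]] : exists n, N n /\ n <> 1.
  apply: contrapT => nN; apply: Nn1; apply/seteqP; split=> [n Nn|_ ->] //.
  by apply: contrapT => n1; apply: nN; exists n.
apply: contrapT => noW; apply: n1.
have /commensurator_finP[P [f fP]] := commensuratorV (NC _ Nn).
pose f2 x := (f x, odd (size x)).
have comm x y : f2 x = f2 y -> n * ltrans (x * y^-1) = ltrans (x * y^-1) * n.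
  case=> /fP; set w := x * y^-1; rewrite /in_conj invgK => -[k _ kE] oxy.
  have ow : even_coxeter (ltrans w).
    by exists w => //; apply/negP; rewrite odd_sizeM odd_sizeV oxy addbb.
  have Nk : N (ltrans (k * w^-1)).
    rewrite ltransM ltransV kE -!mulgA; apply: NM => //.
    by rewrite !mulgA; apply: Nev => //; apply: NV.
  have [kw|kw] := eqVneq (k * w^-1) 1; last by case: noW; exists (k * w^-1).
  have {}kw : k = w by rewrite -(mulgVK w k) kw mul1g.
  by rewrite -[in RHS]kw kE mulgVK.
pose rep p : free_coxeter m := xget 1 [set x | f2 x = p].
have repE x : f2 (rep (f2 x)) = f2 x.
  by rewrite /rep; case: xgetP => // /(_ x) [].
apply: (@bounded_displacement _ (\max_p size ((rep p)^-1 * n (rep p))%g)) => x.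
suff -> : x^-1 * n x = (rep (f2 x))^-1 * n (rep (f2 x)).
  exact: (leq_bigmax (F := fun p => size ((rep p)^-1 * n (rep p)))).
set y := rep _; have fxy : f2 x = f2 y by rewrite /y repE.
have /(congr1 (fun g : tree_aut m => g y)) := comm _ _ fxy.
rewrite !autE !ltransE mulgVK => ->.
by rewrite !mulgA mulVg mul1g.
Qed.

(** [M] stands for the commensurator itself or for its monolith, according to
    which of the two is known to normalise [N]. *)
Section Absorb.
Variables M N : set (tree_aut m).
Hypotheses (M_group : is_subgroup M) (N_group : is_subgroup N).
Hypotheses (M_even : even_coxeter `<=` M) (MC : normalized_by C M).
Hypotheses (N_M : normalized_by M N) (N_W : normalized_by W N).

(** The congruence of two generators modulo [N].  For the twist [g] along the
    segment from [1] to [w * w], the element [h = g k^-1 g k] is in [M].  The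
    second factor [k^-1 g k] of [h] centralises [s_i] and [r = k s_i k^-1],
    because [g] centralises [k s_i k^-1] and its conjugate by [k]; the first
    factor [g] sends [s_i] to [s_j] and centralises [r].  So [s_i r], a
    commutator of [s_i] and [k], is conjugated by [h] to [s_j r]. *)
Lemma gen_pair_in_normalized w a c i j s :
  cox_word w = rcons (a :: s) c -> a != c -> ~~ odd (size w) -> N (ltrans w) ->
  i != a -> i != c -> j != a -> N (ltrans (gen i * gen j)).
Proof.
move=> wE ac evw Nw ia ic ja.
have /is_subgroupP[N1 NM NV] := N_group.
have /is_subgroupP[M1 MM MV] := M_group.
set t := cox_word w in wE.
have rt : reduced t := cox_reduced w.
have rac : reduced (rcons (a :: s) c) by rewrite -wE.
have rtt : reduced (t ++ t).
  by rewrite wE (reduced_cat2 (a :: s)) rac eq_sym ac.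
have wwE : cox_word (w * w) = t ++ t.
  by rewrite -[w in w * _]wordK -[w in _ * w]wordK -word_cat cox_word_word.
have rti : reduced (rcons t i) by rewrite wE reduced_rcons2 rac eq_sym.
have rtti : reduced (rcons (t ++ t) i).
  rewrite rcons_cat wE (reduced_cat2 (a :: s)) rac eq_sym ac /=.
  by move: rti; rewrite wE.
pose X := prefixes (t ++ t).
have XP x := mem_prefixes x rtt.
have Xr : rooted_subtree X by apply: prefixes_rooted.
have Xgen b : b != a -> gen b \notin X.
  by rewrite XP wE /= => /negbTE ->.
have wX : w \in X by rewrite XP prefix_prefix.
have wwX : w * w \in X by rewrite XP wwE prefix_refl.
have wiX : w * gen i \notin X.
  rewrite XP reduced_word_rcons // -cats1 prefix_catr //.
  by rewrite eqxx wE /= (negbTE ia).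
have wwiX : w * w * gen i \notin X.
  rewrite XP reduced_word_rcons wwE //.
  by apply/negP => /size_prefix; rewrite size_rcons ltnn.
have w1 : w != 1.
  by apply/eqP => /(congr1 (@cox_word m)); rewrite -/t wE.
have ww1 : w * w != 1.
  by apply/eqP => /(congr1 (@cox_word m)); rewrite wwE wE.
pose g := fold_twist Xr (Xgen i ia) (Xgen j ja).
have gg : g * g = 1 by apply: twist_sqr.
have gC : C g by apply: fold_twist_commensurates.
have g1 : g * ltrans (gen i) * g = ltrans (gen j) by apply: conj_twist_gen.
pose k := ltrans w.
pose r := k * ltrans (gen i) * k^-1.
have g2 : g * r * g = r.
  by rewrite /r -ltransV -!ltransM; apply: fold_twist_fix_conj.
have g3 : g * (k * r * k^-1) * g = k * r * k^-1.
  have := fold_twist_fix_conj Xr (Xgen i ia) (Xgen j ja) wwX ww1 wwiX.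
  by rewrite -/g invgM !ltransM !ltransV /r -!mulgA.
have gV : g^-1 = g by apply: mulg1_eq.
pose h := g * k^-1 * g * k.
have Mk : M k by apply: M_even; exists w.
have Mh : M h.
  by apply: MM => //; rewrite -[X in _ * X]gV; apply: MC => //; apply: MV.
have hi : h * ltrans (gen i) * h^-1 = ltrans (gen j).
  transitivity (g * (k^-1 * (g * r * g) * k) * g).
    by rewrite /h /r !invgM gV invgK !mulgA.
  by rewrite g2 -g1 /r -!mulgA !mulKg.
have hr : h * r * h^-1 = r.
  transitivity (g * (k^-1 * (g * (k * r * k^-1) * g) * k) * g).
    by rewrite /h !invgM gV invgK !mulgA.
  by rewrite g3 !mulgA !mulgVK -[RHS]g2 /r !mulgA.
have Nir : N (ltrans (gen i) * r).
  have -> : ltrans (gen i) * r =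
      ltrans (gen i) * k * (ltrans (gen i))^-1 * k^-1.
    by rewrite /r -(ltransV (gen i)) gen_inv !mulgA.
  by apply: NM; [apply: N_W => //; eexists | apply: NV].
clearbody h r.
have Njr : N (ltrans (gen j) * r).
  suff -> : ltrans (gen j) * r = h * (ltrans (gen i) * r) * h^-1 by apply: N_M.
  by rewrite -{1}hr -hi !mulgA mulgVK.
have := NM _ _ Nir (NV _ Njr).
by rewrite invgM mulgA mulgK -ltransV gen_inv -ltransM.
Qed.

(** A word [w0] from [a] to [b] is first replaced by [w0 c w0 c] with [c] other
    than [a] and [b]: it is even, and its last letter differs from its first.
    This gives one pair [s_i s_c] in [N], which is again an even word with
    different ends and gives the pairs [s_x s_c] for all other letters [x]. *)
Lemma even_in_normalized :
  (exists2 w, w != 1 & N (ltrans w)) -> even_coxeter `<=` N.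
Proof.
case=> w0 w01 Nw0; have /is_subgroupP[N1 NM NV] := N_group.
have [w [a [c [s [wE ac evw Nw]]]]] : exists w a c s,
    [/\ cox_word w = rcons (a :: s) c, a != c, ~~ odd (size w) & N (ltrans w)].
  case E: (cox_word w0) => [|a s].
    by case/eqP: w01; rewrite -(wordK w0) E word_nil.
  have [c [ca cb]] := avoid2 a (last a s) hm.
  have r0 : reduced (rcons (a :: s) c).
    have := cox_reduced w0; rewrite E /reduced /= rcons_path => -> /=.
    by rewrite eq_sym.
  have E1 : cox_word (w0 * gen c) = rcons (a :: s) c.
    by rewrite reduced_word_rcons E.
  exists (w0 * gen c * (w0 * gen c)), a, c, (s ++ c :: a :: s); split.
  - rewrite -[w0 * gen c]wordK E1 -word_cat cox_word_word.
      by rewrite /= !rcons_cat cat_rcons.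
    by rewrite (reduced_cat2 (a :: s)) r0 ca.
  - by rewrite eq_sym.
  - by rewrite odd_sizeM addbb.
  - rewrite -mulgA ltransM; apply: NM => //.
    have := N_W (x := ltrans w0) (g := ltrans (gen c)).
    rewrite -ltransV -!ltransM gen_inv mulgA; apply=> //.
    by exists (gen c).
have [i [ia ic]] := avoid2 a c hm.
have Nic : N (ltrans (gen i * gen c)).
  have ca : c != a by rewrite eq_sym.
  exact: (gen_pair_in_normalized wE ac evw Nw ia ic ca).
have Nc (x : 'I_m) : N (ltrans (gen x * gen c)).
  have [->|xi] := eqVneq x i; first by [].
  have [->|xc] := eqVneq x c; first by rewrite cox_genK ltrans1.
  have icE : cox_word (gen i * gen c) = rcons [:: i] c.
    by rewrite -!word1 -word_cat cox_word_word //= /reduced /= ic.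
  apply: (gen_pair_in_normalized icE) => //; first by rewrite icE.
  by rewrite eq_sym.
move=> _ [x /= evx <-]; rewrite -(wordK x).
have [n nE] := ubnP (size x).
elim: n (cox_word x) evx nE => // n IHn [|b [|d t]] //= evt lt_t.
  by rewrite word_nil ltrans1.
rewrite !word_cons mulgA ltransM; apply: (NM).
  have -> : gen b * gen d = (gen b * gen c) * (gen d * gen c)^-1.
    by rewrite invgM !gen_inv mulgA genKr.
  by rewrite ltransM ltransV; apply: NM => //; apply: NV.
by apply: IHn; [rewrite negbK in evt | lia].
Qed.

End Absorb.

End Core.

(** * The monolith *)
Lemma comm_of_commutator1 (G : groupType) (x y : G) :
  x * (y * x^-1 * y^-1) = 1 -> x * y = y * x.
Proof. by move=> E; rewrite -[RHS]mul1g -E !mulgA !mulgVK. Qed.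

Section Monolith.
Variables (G : groupType) (H : set G).
Hypothesis H_group : is_subgroup H.

Lemma monolith_subgroup : is_subgroup (monolith H).
Proof.
have /is_subgroupP[H1 HM HV] := H_group.
apply/is_subgroupP; split.
- by split=> // N [[/is_subgroupP[]]].
- move=> x y [Hx Ix] [Hy Iy]; split; first exact: HM.
  move=> N nN; have [[/is_subgroupP[_ NM _] _ _] _] := nN.
  by apply: NM; [apply: Ix | apply: Iy].
- move=> x [Hx Ix]; split; first exact: HV.
  move=> N nN; have [[/is_subgroupP[_ _ NV] _ _] _] := nN.
  by apply: NV; apply: Ix.
Qed.

Lemma monolith_normal : normalized_by H (monolith H).
Proof.
have /is_subgroupP[H1 HM HV] := H_group.
move=> g x Hg [Hx Ix]; split.
  by apply: (HM); [apply: HM | apply: HV].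
by move=> N nN; have [[_ _ Nn] _] := nN; apply: Nn => //; apply: Ix.
Qed.

Lemma monolith_min N : normal_subgroup N H -> N <> [set 1] -> monolith H `<=` N.
Proof. by move=> nN N1 x [_]; apply. Qed.

End Monolith.

Section AlmostSimple.
Variable m : nat.
Hypothesis hm : 2 < m.
Implicit Types (a b c d i j : 'I_m) (s : seq 'I_m) (w : free_coxeter m).
Implicit Types (g h k : tree_aut m) (M N : set (tree_aut m)).

Local Notation gen := (@cox_gen m).
Local Notation W := (coxeter_in_aut m).
Local Notation C := (commensurator W).
Local Notation M := (monolith C).
Local Notation even := (@even_coxeter m).

Let C_group : is_subgroup C := commensurator_subgroup m.
Let M_group : is_subgroup M := monolith_subgroup C_group.
Let M_normal : normalized_by C M := monolith_normal C_group.

Lemma cox_aut_commensurates g : W g -> C g.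
Proof. by case=> w _ <-; apply: ltrans_commensurates. Qed.

Lemma even_nontrivial N : even `<=` N -> N <> [set 1].
Proof.
move=> evN N1; pose a := Ordinal (ltnW (ltnW hm)); pose b := Ordinal (ltnW hm).
have := evN _ (even_gen2 a b); rewrite N1 /= -ltrans1 => /ltrans_inj.
by move/(congr1 (@cox_word m)).
Qed.

Lemma normal_contains_even N :
  normal_subgroup N C -> N <> [set 1] -> even `<=` N.
Proof.
move=> [N_group NC NN] N1.
have evC : even `<=` C by move=> _ [w _ <-]; apply: ltrans_commensurates.
apply: (@even_in_normalized m hm C) => //.
- move=> g x Cg Cx; have /is_subgroupP[_ CM CV] := C_group.
  by apply: (CM); [apply: CM | apply: CV].
- by move=> g x Wg; apply: NN; apply: cox_aut_commensurates.
- by apply: meets_coxeter => // g x eg; apply: NN; apply: evC.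
Qed.

Lemma even_monolith : even `<=` M.
Proof.
move=> g eg; split=> [|N [nN N1]]; last exact: normal_contains_even eg.
by case: eg => w _ <-; apply: ltrans_commensurates.
Qed.

(** The group [N] is normalised by [W+] but perhaps not by [W]; the group
    [K = N] intersected with its conjugate by one generator [s] is normalised by
    [W], as [W+] and [s] generate [W].  It contains the commutator of [w] and
    its conjugate by [s] for [w] in [N], which is not trivial when [s] is
    neither the first nor the last letter of [w]. *)
Lemma monolith_normal_contains_even N :
  normal_subgroup N M -> N <> [set 1] -> even `<=` N.
Proof.
move=> [N_group NsM NN] N1.
have /is_subgroupP[M1 MM MV] := M_group.
have /is_subgroupP[N_1 NM NV] := N_group.
have [w w1 Nw] : exists2 w, w != 1 & N (ltrans w).
  apply: meets_coxeter => //; first by move=> g /NsM[].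
  by move=> g x eg; apply: NN; apply: even_monolith.
have [a [b [t wE]]] : exists a b t, cox_word w = a :: t /\ last a t = b.
  case E: (cox_word w) => [|a t]; last by exists a, (last a t), t.
  by case/eqP: w1; rewrite -(wordK w) E word_nil.
case: wE => wE lE; have [c [ca cb]] := avoid2 a b hm.
pose s := ltrans (gen c); have ss : s * s = 1.
  by rewrite -ltransM cox_genK ltrans1.
have sV : s^-1 = s by apply: mulg1_eq.
have Ms (x : tree_aut m) : M x -> M (s * x * s).
  by move/(M_normal (ltrans_commensurates (gen c))); rewrite -/s sV.
pose K := [set x | N x /\ N (s * x * s)].
have sM (x y : tree_aut m) : s * (x * y) * s = s * x * s * (s * y * s).
  by rewrite !mulgA -[in RHS](mulgA _ s s) ss mulg1.
have sV' (x : tree_aut m) : s * x^-1 * s = (s * x * s)^-1.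
  by rewrite !invgM sV mulgA.
have sK (x : tree_aut m) : s * (s * x * s) * s = x.
  by rewrite !mulgA ss mul1g -mulgA ss mulg1.
suff : even `<=` K by move=> eK x /eK[].
apply: (@even_in_normalized m hm M) => //.
- apply/is_subgroupP; split.
  + by split=> //; rewrite mulg1 ss.
  + by move=> x y [Nx Nsx] [Ny Nsy]; split; rewrite ?sM; apply: NM.
  + by move=> x [Nx Nsx]; split; rewrite ?sV'; apply: NV.
- exact: even_monolith.
- move=> g x Mg [Nx Nsx]; split; first exact: NN.
  by rewrite !sM sV'; apply: NN => //; apply: Ms.
- move=> _ x [v _ <-] [Nx Nsx].
  have step u y : N y -> N (s * y * s) -> N (ltrans u * y * (ltrans u)^-1).
    move=> Ny Nsy; case: (boolP (odd (size u))) => ou; last first.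
      by apply: NN => //; apply: even_monolith; exists u.
    have -> : ltrans u * y * (ltrans u)^-1 =
        ltrans (u * gen c) * (s * y * s) * (ltrans (u * gen c))^-1.
      by rewrite ltransM -/s !invgM sV !mulgA -(mulgA _ s s) ss mulg1
        -(mulgA _ s s) ss mulg1.
    apply: NN => //; apply: even_monolith; exists (u * gen c) => //.
    by apply/negP; rewrite odd_size_gen ou.
  split; first exact: step.
  have -> : s * (ltrans v * x * (ltrans v)^-1) * s =
      ltrans (gen c * v) * x * (ltrans (gen c * v))^-1.
    by rewrite ltransM -/s invgM sV !mulgA.
  exact: step.
- pose u := gen c * w * gen c.
  have uE : ltrans u = s * ltrans w * s by rewrite !ltransM.
  exists (w * (u * w^-1 * u^-1)).
    apply/eqP => /comm_of_commutator1/(congr1 (@cox_word m)).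
    have rw : reduced (rcons (a :: t) c).
      have := cox_reduced w; rewrite wE /reduced /= rcons_path => -> /=.
      by rewrite lE eq_sym.
    have wcE : cox_word (w * gen c) = rcons (a :: t) c.
      by rewrite reduced_word_rcons wE.
    have rwcw : reduced (rcons (a :: t) c ++ rcons (a :: t) c).
      by rewrite (reduced_cat2 (a :: t)) rw ca.
    have rwcw' : reduced (c :: a :: t ++ c :: a :: t).
      have r2 : reduced (a :: t ++ c :: a :: t).
        apply: (@reduced_catl _ _ [:: c]).
        suff -> : (a :: t ++ c :: a :: t) ++ [:: c] =
            rcons (a :: t) c ++ rcons (a :: t) c by [].
        by rewrite cat_rcons -cats1 /= -catA.
      by rewrite (reduced_cat2 [::] c a) ca r2.
    have -> : w * u = w * gen c * (w * gen c) by rewrite /u !mulgA.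
    have -> : u * w = word (c :: a :: t ++ c :: a :: t).
      have -> : c :: a :: t ++ c :: a :: t =
          [:: c] ++ cox_word w ++ [:: c] ++ cox_word w by rewrite wE.
      by rewrite !word_cat word1 wordK /u !mulgA.
    rewrite -(wordK (w * gen c)) wcE -word_cat !cox_word_word //=.
    by case=> ac; rewrite ac eqxx in ca.
  clearbody u.
  have Mk : M (ltrans w) := NsM _ Nw.
  have Mu : M (ltrans u) by rewrite uE; apply: Ms.
  rewrite !ltransM !ltransV; split.
    by apply: (NM) => //; apply: NN => //; apply: NV.
  have uE' : s * ltrans u * s = ltrans w by rewrite uE sK.
  rewrite !sM !sV' uE' -!uE !mulgA; apply: (NM); last by apply: NV.
  by apply: NN.
Qed.

(** Every [C]-conjugate of a non-trivial normal subgroup [N] of the monolith is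
    such a subgroup, hence contains [W+]; so the intersection [K] of these
    conjugates is a non-trivial normal subgroup of [C] and contains the
    monolith. *)
Lemma monolith_simple : is_simple M.
Proof.
split=> //; first by apply: even_nontrivial; apply: even_monolith.
move=> N nN; have [N1|N1] := pselect (N = [set 1]); [by left | right].
have [N_group NM NN] := nN.
have /is_subgroupP[C1 CM CV] := C_group.
have /is_subgroupP[N_1 N_M NV] := N_group.
apply/seteqP; split=> //.
pose K := [set x | forall g, C g -> N (g^-1 * x * g)].
have KN : K `<=` N by move=> x /(_ 1 C1); rewrite invg1 mulg1 mul1g.
have conjM (c x y : tree_aut m) :
    c^-1 * (x * y) * c = c^-1 * x * c * (c^-1 * y * c).
  by rewrite !mulgA mulgK.
have evK : even `<=` K.
  move=> x ex c Cc.
  pose Nc := [set y | N (c^-1 * y * c)].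
  suff : even `<=` Nc by apply.
  apply: monolith_normal_contains_even.
    split.
    - apply/is_subgroupP; split.
      + by rewrite /Nc /= mulg1 mulVg.
      + by move=> y z Ny Nz; rewrite /Nc /= conjM; apply: N_M.
      + by move=> y /NV; rewrite /Nc /= !invgM invgK mulgA.
    - move=> y /NM/(M_normal Cc).
      by rewrite !mulgA mulgV mul1g mulgK.
    - move=> g y Mg Ny; rewrite /Nc /= !conjM.
      have -> : c^-1 * g^-1 * c = (c^-1 * g * c)^-1.
        by rewrite !invgM invgK mulgA.
      apply: NN => //.
      by rewrite -[X in _ * X](invgK c); apply: M_normal => //; apply: CV.
  move=> Nc1; apply: N1; apply/seteqP; split=> [y Ny|_ ->//].
  have : Nc (c * y * c^-1) by rewrite /Nc /= !mulgA mulVg mul1g mulgVK.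
  rewrite Nc1 /= => yc; apply: (mulgI c); apply: (mulIg c^-1).
  by rewrite yc mulg1 mulgV.
apply: subset_trans (KN); apply: monolith_min; last exact: even_nontrivial.
split.
- apply/is_subgroupP; split.
  + by move=> c Cc; rewrite mulg1 mulVg.
  + by move=> x y Kx Ky c Cc; rewrite conjM; apply: N_M; [apply: Kx|apply: Ky].
  + move=> x Kx c Cc; have := NV _ (Kx c Cc).
    by rewrite !invgM invgK mulgA.
- by move=> x /KN/NM[].
- move=> g x Cg Kx c Cc.
  have := Kx (g^-1 * c); rewrite invgM invgK !mulgA; apply.
  by apply: CM => //; apply: CV.
Qed.

Lemma monolith_nonabelian : ~ is_abelian M.
Proof.
move=> ab; pose a := Ordinal (ltnW (ltnW hm)); pose b := Ordinal (ltnW hm).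
pose c := Ordinal hm.
have := ab _ _ (even_monolith (even_gen2 a b)) (even_monolith (even_gen2 a c)).
rewrite /commute -!ltransM => /ltrans_inj.
by move/(congr1 (@cox_word m)).
Qed.

Lemma commensurator_almost_simple : almost_simple C.
Proof.
split; [split=> // | exact: monolith_simple | exact: monolith_nonabelian].
by apply: even_nontrivial; apply: even_monolith.
Qed.

Lemma even_finite_index :
  [/\ is_subgroup even, even `<=` W & finite_index even W].
Proof.
have evE x : even (ltrans x) <-> ~~ odd (size x).
  by split=> [[y oy /ltrans_inj <-]|ox]; last by exists x.
have ev_group : is_subgroup even.
  apply/is_subgroupP; split.
  - by rewrite -ltrans1; exists 1.
  - move=> _ _ [x /negbTE ox <-] [y /negbTE oy <-].
    by rewrite -ltransM; apply/evE; rewrite odd_sizeM ox oy.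
  - move=> _ [x ox <-]; rewrite -ltransV; apply/evE; by rewrite odd_sizeV.
split=> //; first by move=> _ [x _ <-]; exists x.
pose a := Ordinal (ltnW (ltnW hm)).
apply: (sub_finite_set (B :=
  [set lcoset_set even 1; lcoset_set even (ltrans (gen a))]));
  last exact: finite_set2.
move=> _ [_ [x _ <-] <-].
have cE (y z : free_coxeter m) : odd (size y) = odd (size z) ->
    lcoset_set even (ltrans y) = lcoset_set even (ltrans z).
  move=> oyz; rewrite -[y]invgK -[z]invgK !ltransV.
  apply/lcoset_inv_eq => //; rewrite invgK -ltransV -ltransM.
  by apply/evE; rewrite odd_sizeM odd_sizeV oyz addbb.
case: (boolP (odd (size x))) => ox; [right | left].
  by apply: cE; rewrite ox.
by rewrite -ltrans1; apply: cE; rewrite (negbTE ox).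
Qed.

End AlmostSimple.

(** * The closure of the monolith *)
Section Density.
Variable m : nat.
Hypothesis hm : 2 < m.
Implicit Types (a b c d i j : 'I_m) (s t : seq 'I_m).
Implicit Types (x y z w v : free_coxeter m).
Implicit Types (g h k : tree_aut m).

Local Notation gen := (@cox_gen m).
Local Notation W := (coxeter_in_aut m).
Local Notation C := (commensurator W).
Local Notation M := (monolith C).
Local Notation even := (@even_coxeter m).

Lemma aut_parity g x : odd (size (g x)) = odd (size x) (+) odd (size (g 1)).
Proof.
elim/free_coxeter_ind: x => [//|x c IHx].
have [d ->] := aut_gen g x c.
by rewrite !odd_size_gen IHx addNb.
Qed.

Lemma aut_plusP g : aut_plus m g <-> ~~ odd (size (g 1)).
Proof.
rewrite /aut_plus /same_class /=; split=> [/(_ 1) /=|og x].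
  by rewrite eqbF_neg.
by rewrite aut_parity (negbTE og) addbF.
Qed.

Lemma monolith_plus : M `<=` aut_plus m.
Proof.
have /is_subgroupP[C1 CM CV] := commensurator_subgroup m.
have plusM g h : aut_plus m g -> aut_plus m h -> aut_plus m (g * h).
  rewrite !aut_plusP autE => og oh.
  by rewrite aut_parity (negbTE og) (negbTE oh).
have plusE g : aut_plus m g <-> forall x, odd (size (g x)) = odd (size x).
  split=> [/aut_plusP/negbTE og x|gx]; last by apply/aut_plusP; rewrite gx.
  by rewrite aut_parity og addbF.
suff : M `<=` C `&` aut_plus m by move=> sM g /sM[].
apply: monolith_min.
  split; [apply/is_subgroupP; split | by move=> g [] |].
  - by split=> // x; rewrite /same_class.
  - by move=> g h [Cg pg] [Ch ph]; split; [apply: CM | apply: plusM].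
  - move=> g [Cg /plusE pg]; split; first exact: CV.
    by apply/plusE => x; rewrite -[in RHS](autVK g x) pg.
  - move=> g h Cg [Ch /plusE ph]; split.
      by apply: (CM); [apply: CM | apply: CV].
    apply/plusE => x; rewrite !autE aut_parity ph -[in RHS](autVK g x).
    by rewrite -(aut_parity g (g^-1 x)).
apply: even_nontrivial => // _ [w ew <-]; split.
  exact: ltrans_commensurates.
by apply/aut_plusP; rewrite ltransE mulg1.
Qed.

(** An element of the monolith that acts on a large ball as the exchange of the
    two edges of colours [i] and [j] at [v], up to what happens in the two
    branches behind these edges.  With [v] moved to [1], let [X] consist of the
    words of bounded length that do not start with [i] or [j], and let [k] be a
    long even word starting with another letter.  Then [k] moves a ball around
    [1] into [X], which the twist [g] fixes, so that [g k^-1 g k] agrees with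
    [g] on this ball. *)
Lemma monolith_swap v i j n : i != j -> exists F, [/\ M F,
  F (v * gen i) = v * gen j, F (v * gen j) = v * gen i &
  forall y, size y <= n -> ohead (v^-1 * y) != Some i ->
    ohead (v^-1 * y) != Some j -> F y = y].
Proof.
move=> ij; have [a [ai aj]] := avoid2 i j hm.
pose n' := (n + size v).+1; pose kw := (gen a * gen i) ^+ n'.
have kwE : cox_word kw = flatten (nseq n' [:: a; i]) by apply: alternating_word.
have size_kw : size kw = n'.*2.
  rewrite kwE; elim: {1 2}n' => //= r ->; by rewrite doubleS.
pose E := (size kw + n')%N.
pose X := [seq x : free_coxeter m <- ball m E |
  [&& size x <= E, ohead x != Some i & ohead x != Some j]].
have XP x : (x \in X) = [&& size x <= E, ohead x != Some i & ohead x != Some j].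
  rewrite mem_filter; case: (boolP (size x <= E)) => //= xE.
  by rewrite ball_mem // andbT.
have Xr : rooted_subtree X.
  split=> [|x c]; first by rewrite XP.
  rewrite !XP => /reduced_word_rcons ->; rewrite size_rcons.
  case: (cox_word x) => [|b s] //= /and3P[lt_s -> ->].
  by rewrite ltnW.
have Xi : gen i \notin X by rewrite XP /= eqxx andbF.
have Xj : gen j \notin X by rewrite XP /= eqxx !andbF.
pose g := fold_twist Xr Xi Xj; pose k := ltrans kw.
have gX x : x \in X -> g x = x by apply: fold_twist_fix.
have gi : g (gen i) = gen j.
  by rewrite /g /= twist_from_gen /relabel eqxx tpermL.
have gj : g (gen j) = gen i.
  by rewrite /g /= twist_from_gen /relabel eqxx tpermR.
have gC : C g by apply: fold_twist_commensurates.
have gV : g^-1 = g by apply/mulg1_eq/twist_sqr.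
have /is_subgroupP[_ MM MV] := monolith_subgroup (commensurator_subgroup m).
have MC := monolith_normal (commensurator_subgroup m).
have Mk : M k.
  by apply: even_monolith => //; exists kw => //=; rewrite size_kw odd_double.
pose f := g * k^-1 * g * k.
have Mf : M f.
  by apply: MM => //; rewrite -[X in _ * X]gV; apply: MC => //; apply: MV.
have fg z : size z <= n' -> f z = g z.
  move=> zn; have kzX : kw * z \in X.
    rewrite XP ohead_mul; last by rewrite size_kw -addnn /n'; lia.
    rewrite (leq_trans (size_mul _ _)) ?leq_add2l //=.
    rewrite kwE /n' /=; apply/andP.
    by split; apply/eqP => -[/eqP]; apply/negP.
  rewrite /f !autE ltransE (gX _ kzX) -ltransV ltransE mulKg //.
clearbody f.
exists (ltrans v * f * (ltrans v)^-1); split.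
- by apply: MC => //; apply: ltrans_commensurates.
- by rewrite -ltransV !autE !ltransE mulKg fg // gi.
- by rewrite -ltransV !autE !ltransE mulKg fg // gj.
- move=> y yn hi hj; rewrite -ltransV !autE !ltransE.
  have zn : size (v^-1 * y) <= n'.
    by rewrite (leq_trans (size_mul _ _)) // size_inv addnC leqW // leq_add2r.
  by rewrite fg // gX ?mulVKg // XP hi hj !andbT (leq_trans zn) // leq_addl.
Qed.

(** If [h] agrees with [g] on a subtree and [v * s_c] is a new leaf, then
    [h^-1 g] fixes the subtree and sends the leaf to another neighbour
    [v * s_d] of [v].  Neither neighbour is in the subtree, so that by convexity
    the subtree avoids both branches, and the exchange of the two edges corrects
    [h] without disturbing the subtree. *)
Lemma extend_agreement g X y : rooted_subtree X ->
  (exists2 h, M h & {in X, h =1 g}) ->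
  exists X', [/\ rooted_subtree X', {subset X <= X'}, y \in X' &
    exists2 h, M h & {in X', h =1 g}].
Proof.
move=> XX XM; rewrite -(wordK y); have := cox_reduced y.
elim/last_ind: (cox_word y) => [|s c IHs] rs.
  by exists X; split=> //; rewrite word_nil; apply: XX.1.
have /IHs[{IHs XX XM}X' [XX sub vX' [h Mh hg]]] : reduced s.
  exact: reduced_rconsl rs.
have sE : cox_word (word s) = s.
  by apply: cox_word_word; move: rs; rewrite -cats1; apply: reduced_catl.
rewrite word_rcons; move: (word s) sE vX' => v vE vX'.
have [?|vcX] := boolP (v * gen c \in X').
  by exists X'; split=> //; exists h.
pose X2 := v * gen c :: X'.
have XX2 : rooted_subtree X2.
  split; first by rewrite inE XX.1 orbT.
  move=> x d rxd; rewrite !inE => /orP[/eqP xE|/(XX.2 _ _ rxd) ->];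
    last by rewrite orbT.
  have : cox_word (x * gen d) = cox_word (v * gen c) by rewrite xE.
  rewrite !reduced_word_rcons ?vE // => /rcons_inj[xs _].
  by rewrite -(wordK x) xs -vE wordK vX' orbT.
suff [h2 Mh2 h2g] : exists2 h2, M h2 & {in X2, h2 =1 g}.
  exists X2; split=> //; [|exact: mem_head|by exists h2].
  by move=> x /sub; rewrite inE orbC => ->.
pose p := h^-1 * g.
have pX x : x \in X' -> p x = x by move=> xX; rewrite autE -hg // autK.
have [d] := aut_gen p v c; rewrite (pX v vX') => pd.
have hp x : g x = h (p x) by rewrite !autE autVK.
have [dc|dc] := eqVneq d c.
  exists h => // x; rewrite inE => /orP[/eqP->|/hg//].
  by rewrite hp pd dc.
pose n := \max_(x <- X') size x.
have [F [MF Fc Fd FX]] : exists F, [/\ M F, F (v * gen c) = v * gen d,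
   F (v * gen d) = v * gen c &
   forall y, size y <= n -> ohead (v^-1 * y) != Some c ->
    ohead (v^-1 * y) != Some d -> F y = y].
  by apply: monolith_swap; rewrite eq_sym.
have /is_subgroupP[_ MM _] := monolith_subgroup (commensurator_subgroup m).
exists (h * F); first exact: MM.
move=> x; rewrite inE => /orP[/eqP->|xX]; first by rewrite autE Fc hp pd.
rewrite autE FX ?hg //.
- exact: (leq_bigmax_seq (F := fun x : free_coxeter m => size x)).
- by apply: contraNneq vcX => /(rooted_convex XX vX' xX).
- apply: contraNneq dc => /(rooted_convex XX vX' xX)/pX.
  move=> pvd; apply/eqP/gen_inj/(mulgI v)/(@aut_inj _ p).
  by rewrite pvd pd.
Qed.

Lemma monolith_closure : closure M = aut_plus m.
Proof.
apply/seteqP; split=> g.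
  move/closure_autP/(_ [:: 1]) => [h /monolith_plus/aut_plusP h1 hg].
  by apply/aut_plusP; rewrite -hg ?mem_head.
move=> /aut_plusP g1; apply/closure_autP => s.
suff [X [_ sX [h Mh hg]]] : exists X, [/\ rooted_subtree X, {subset s <= X} &
    exists2 h, M h & {in X, h =1 g}].
  by exists h => // x /sX/hg.
elim: s => [|y s [X [XX sX XM]]].
  exists [:: 1]; split=> //.
    split; first exact: mem_head.
    move=> x c rxc; rewrite inE => /eqP xc.
    by have := reduced_word_rcons rxc; rewrite xc; case: (cox_word x).
  exists (ltrans (g 1)); first by apply: even_monolith => //; exists (g 1).
  by move=> x; rewrite inE => /eqP ->; rewrite ltransE mulg1.
have [X' [XX' XsX' yX' XM']] := extend_agreement y XX XM.
by exists X'; split=> // x; rewrite inE => /orP[/eqP->//|/sX/XsX'].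
Qed.

End Density.

(** * Infinite generation of the monolith *)
Section CoprimePowers.
Variables (m p : nat).
Hypothesis p_prime : prime p.
Implicit Types (w : free_coxeter m) (g h k : tree_aut m).

Local Notation C := (commensurator (coxeter_in_aut m)).

(** For prime [p], a consequence of the index in [W] of its intersection with
    the conjugate by [h] being less than [p]; unlike this bound it is stable
    under products. *)
Definition coprime_power h : Prop :=
  forall w, exists2 e, ~~ (p %| e) & in_conj h (w ^+ e).

Lemma coprime_power1 : coprime_power 1.
Proof.
move=> w; exists 1%N; first by rewrite Euclid_dvd1.
by rewrite /in_conj invg1 mul1g mulg1; eexists.
Qed.

Lemma coprime_powerM g h :
  coprime_power g -> coprime_power h -> coprime_power (g * h).
Proof.
move=> cg ch w; have [e pe [v _ vE]] := cg w; have [f pf hf] := ch v.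
exists (e * f)%N; first by rewrite Euclid_dvdM // negb_or pe.
move: hf; rewrite /in_conj ltransX vE expgnA [in X in _ -> X]ltransX invgM.
have conjX n x : (g^-1 * x * g) ^+ n = g^-1 * x ^+ n * g.
  elim: n => [|n IHn]; first by rewrite !expg0 mulg1 mulVg.
  by rewrite !expgS IHn !mulgA mulgK.
by rewrite conjX !mulgA.
Qed.

Lemma coprime_power_subgroup :
  is_subgroup [set h | coprime_power h /\ coprime_power h^-1].
Proof.
apply/is_subgroupP; split.
- by split; rewrite ?invg1; apply: coprime_power1.
- move=> g h [cg cgV] [ch chV]; split; first exact: coprime_powerM.
  by rewrite invgM; apply: coprime_powerM.
- by move=> g [cg cgV]; split; rewrite ?invgK.
Qed.

End CoprimePowers.

(** Beyond the exponents needed for the finitely many generators and their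
    inverses, a prime divides none of these exponents. *)
Lemma finitely_generated_coprime_power m (M : set (tree_aut m)) :
  M `<=` commensurator (coxeter_in_aut m) -> finitely_generated M ->
  exists n, forall p, prime p -> n < p -> M `<=` @coprime_power m p.
Proof.
move=> MC [A /finite_seqP[s sE] ME].
have sC h : h \in s -> commensurator (coxeter_in_aut m) h.
  move=> hs; apply: MC; rewrite ME; apply: sub_gen_smallest.
  by rewrite sE.
have [n nP] : exists n, forall h, h \in s ->
    (forall w, exists2 e, 0 < e <= n & in_conj h (w ^+ e)) /\
    (forall w, exists2 e, 0 < e <= n & in_conj h^-1 (w ^+ e)).
  elim: s sC {sE} => [|h s IHs] sC; first by exists 0%N.
  have [|n nP] := IHs; first by move=> k ks; apply: sC; rewrite inE ks orbT.
  have [n1 n1P] := commensurator_pow (sC h (mem_head _ _)).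
  have [n2 n2P] := commensurator_pow (commensuratorV (sC h (mem_head _ _))).
  exists (n1 + n2 + n)%N => k.
  rewrite inE => /orP[/eqP->|/nP[P1 P2]]; split=> w.
  - by have [e ? ?] := n1P w; exists e => //; lia.
  - by have [e ? ?] := n2P w; exists e => //; lia.
  - by have [e ? ?] := P1 w; exists e => //; lia.
  - by have [e ? ?] := P2 w; exists e => //; lia.
exists n => p p_prime np.
suff : M `<=` [set h | coprime_power p h /\ coprime_power p h^-1].
  by move=> sM h /sM[].
rewrite ME; apply: smallest_sub; first exact: coprime_power_subgroup.
rewrite sE => h /nP[P1 P2].
split=> w; [have [e en he] := P1 w | have [e en he] := P2 w]; exists e => //.
  by apply/negP => /dvdn_leq; lia.
by apply/negP => /dvdn_leq; lia.
Qed.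

Section LargePrime.
Variables (m p : nat) (a b c : 'I_m).
Hypotheses (p_prime : prime p) (p_gt2 : 2 < p).
Hypotheses (ab : a != b) (ac : a != c) (bc : b != c).
Implicit Types (x y w : free_coxeter m).

Local Notation gen := (@cox_gen m).
Local Notation W := (coxeter_in_aut m).

(** The letters [a] and [b] act on the residues mod [p] as two reflections of
    the [p]-gon, whose product is the rotation by 1; the other letters act
    trivially.  The residue 0 is fixed by [a] and [c]. *)
Definition dihedral_step (q : 'Z_p) (d : 'I_m) : 'Z_p :=
  (if d == a then - q else if d == b then 1 - q else q)%R.

Lemma dihedral_stepK q d : dihedral_step (dihedral_step q d) d = q.
Proof.
rewrite /dihedral_step; case: eqP => _; first exact: GRing.opprK.
by case: eqP => _ //; apply: GRing.subKr.
Qed.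

Lemma dihedral_a : dihedral_step 0%R a = 0%R.
Proof. by rewrite /dihedral_step eqxx GRing.oppr0. Qed.

Lemma dihedral_c : dihedral_step 0%R c = 0%R.
Proof. by rewrite /dihedral_step ![c == _]eq_sym (negbTE ac) (negbTE bc). Qed.

Definition rotation : free_coxeter m := gen a * gen b.

Local Notation act := (act dihedral_step).

Lemma act_rotation q n : act q (rotation ^+ n) = (n%:R + q)%R.
Proof.
elim: n q => [|n IHn] q; first by rewrite GRing.add0r.
rewrite expgS actM; last exact: dihedral_stepK.
rewrite IHn /rotation actM ?act_gen; last exact: dihedral_stepK.
rewrite /dihedral_step eqxx eq_sym (negbTE ab) eqxx GRing.opprK.
by rewrite GRing.addrA -GRing.mulrSr.
Qed.

Lemma natr_Zp_eq n k : (n%:R == k%:R :> 'Z_p)%R = (n == k %[mod p]).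
Proof.
have p1 := prime_gt1 p_prime.
by rewrite -val_eqE /= !val_Zp_nat.
Qed.

Definition dihedral_twist : tree_aut m :=
  twist dihedral_stepK dihedral_a dihedral_c.

Local Notation g := dihedral_twist.

(** Let [x] be the conjugate by [g] of the [e]-th power of the rotation.  By
    assumption the three conjugates of [x] by powers of the rotation with
    exponents [l < 3] are moved into [W] by [g].  If [g] changes colours neither
    at the image of [y] nor at the image of [x y] under the [l]-th power of the
    rotation, this shows that [x] preserves colours at [y].  Such an [l] exists
    for every [y], as for each of the two vertices at most one [l] is excluded.
    So [x] is in [W], and comparing the colours at [1] and at its image under
    [x] shows that the [e]-th power of the rotation fixes the residue 0. *)
Lemma dihedral_twist_rotation e :
  (forall l, 0 < l < 3 ->
    in_conj (g * ltrans (rotation ^- l) * g) (rotation ^+ e)) ->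
  p %| e.
Proof.
move=> fix_l; pose u l := ltrans (rotation ^+ l).
have gg : g * g = 1 by apply: twist_sqr.
have gV : g^-1 = g by apply: mulg1_eq.
pose x := g * u e * g.
have Wx l : l < 3 -> W (g * (u l * x * (u l)^-1) * g).
  case: l => [|l] ltl.
    rewrite /u expg0 ltrans1 invg1 mulg1 mul1g /x.
    rewrite !mulgA gg mul1g -mulgA gg mulg1.
    by eexists.
  have := fix_l l.+1 ltl; rewrite /in_conj !invgM gV -!ltransV invgK.
  by rewrite -/(u _) -/(u e) /x /u ltransV !mulgA.
have WxT : W x.
  apply/cox_autP => y d.
  have injl z l l' : l < 3 -> l' < 3 ->
      act 0%R (rotation ^+ l * z) = 0%R ->
      act 0%R (rotation ^+ l' * z) = 0%R -> l = l'.
    move=> l3 l'3; rewrite !actM; try exact: dihedral_stepK.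
    rewrite !act_rotation !GRing.addr0 => zl zl'.
    have /eqP := act_inj dihedral_stepK (etrans zl (esym zl')).
    by rewrite natr_Zp_eq !modn_small; [move/eqP | lia | lia].
  have [l [l3 yl xyl]] : exists l, [/\ l < 3,
      act 0%R (rotation ^+ l * y) != 0%R &
      act 0%R (rotation ^+ l * x y) != 0%R].
    apply: contrapT => nol.
    have bad l : l < 3 -> act 0%R (rotation ^+ l * y) = 0%R \/
        act 0%R (rotation ^+ l * x y) = 0%R.
      move=> l3; have [|yl] := eqVneq (act 0%R (rotation ^+ l * y)) 0%R.
        by left.
      have [|xyl] := eqVneq (act 0%R (rotation ^+ l * x y)) 0%R; first by right.
      by case: nol; exists l.
    by case: (bad 0%N isT) => E0; case: (bad 1%N isT) => E1;
      case: (bad 2%N isT) => E2;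
      first [by have := injl _ 0%N 1%N isT isT E0 E1
            |by have := injl _ 0%N 2 isT isT E0 E2
            |by have := injl _ 1%N 2 isT isT E1 E2].
  have [t _ tE] := Wx l l3.
  have xE z : rotation ^+ l * x z = g (t * g (rotation ^+ l * z)).
    rewrite -[t * _]ltransE tE !autE -/(dihedral_twist) !twistK.
    by rewrite -ltransV !ltransE mulKg.
  apply: (mulgI (rotation ^+ l)); rewrite xE mulgA twist_gen.
  rewrite {1}/relabel (negbTE yl) mulgA twist_gen.
  have -> : act 0%R (t * g (rotation ^+ l * y)) = act 0%R (rotation ^+ l * x y).
    by rewrite xE [RHS](act_twist dihedral_stepK dihedral_a dihedral_c).
  by rewrite /relabel (negbTE xyl) mulgA -xE.
have /cox_autP/(_ 1 c) := WxT; rewrite !mul1g.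
have xE z : x z = g (rotation ^+ e * g z) by [].
have gc : g (gen c) = gen a.
  by rewrite /g /= twist_from_gen /relabel eqxx tpermR.
rewrite !xE gc twist_gen [g 1]twist_at1 mulg1 => /mulgI/gen_inj.
rewrite /relabel; case: eqP => [|_ /eqP]; last by rewrite (negbTE ac).
rewrite act_rotation GRing.addr0 => /eqP.
by rewrite (natr_Zp_eq e 0) mod0n => /eqP e0 _; apply/eqP.
Qed.

End LargePrime.

Lemma monolith_not_finitely_generated m : 2 < m ->
  ~ finitely_generated (monolith (commensurator (coxeter_in_aut m))).
Proof.
move=> hm fg; set M := monolith _ in fg.
have [|n nP] := finitely_generated_coprime_power _ fg; first by move=> g [].
have [p pn p_prime] := prime_above (maxn n 2).
have p_gt2 : 2 < p by rewrite (leq_ltn_trans (leq_maxr n 2)).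
have {nP}cop : M `<=` @coprime_power m p.
  by apply: nP => //; rewrite (leq_ltn_trans (leq_maxl n 2)).
pose a := Ordinal (ltnW (ltnW hm)); pose b := Ordinal (ltnW hm).
pose c := Ordinal hm.
pose g := @dihedral_twist m p a b c isT isT.
have gV : g^-1 = g by apply/mulg1_eq/twist_sqr.
have Mh l : M (g * ltrans (rotation a b ^- l) * g).
  rewrite -[X in _ * X]gV; apply: monolith_normal.
  - exact: commensurator_subgroup.
  - exact: twist_commensurates.
  - apply: even_monolith => //; exists (rotation a b ^- l) => //.
    apply/negP; rewrite odd_sizeV; elim: l => // l IHl.
    by rewrite expgS odd_sizeM /rotation odd_sizeM.
have [e1 pe1 h1] := cop _ (Mh 1%N) (rotation a b).
have [e2 pe2 h2] := cop _ (Mh 2) (rotation a b ^+ e1).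
have : p %| e1 * e2.
  apply: (@dihedral_twist_rotation m p a b c p_prime p_gt2 isT isT isT).
  move=> l; rewrite expgnA; case: l => [|[|[|l]]] // _.
  exact: in_conjX.
by rewrite Euclid_dvdM // (negbTE pe1) (negbTE pe2).
Qed.

Theorem theoremA1 (m : nat) (hm : 3 <= m) :
  let W : set (tree_aut m) := coxeter_in_aut m in
  let C : set (tree_aut m) := commensurator W in
  [/\ almost_simple C,
      (exists H : set (tree_aut m),
        [/\ is_subgroup H, H `<=` W, finite_index H W & H `<=` monolith C]),
      closure (monolith C) = aut_plus m
    & ~ finitely_generated (monolith C)].
Proof.
split; first exact: commensurator_almost_simple.
- exists (@even_coxeter m); have [ev_group evW evf] := even_finite_index hm.
  by split=> //; apply: even_monolith.
- exact: monolith_closure.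
- exact: monolith_not_finitely_generated.
Qed.
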